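(* Let $\mathcal F$ be a set of representations of a $C^*$-algebra $A$ (possibly without unit). If $\mathcal F$ is exhausting, then $\mathcal F$ is invertibility sufficient and hence also strictly norming. If $\mathcal F$ is strictly norming, then it is also faithful.
   Context: A representation of a $C^*$-algebra $A$ is a $*$-morphism $\phi: A\to\mathcal L(\mathcal H_\phi)$ into the algebra of bounded operators on a Hilbert space $\mathcal H_\phi$. If $A$ has no unit, $A^+ := A\oplus\mathbb C$ denotes the algebra with adjoined unit, with its unique $C^*$-norm. A set $\mathcal F$ of representations of $A$ is: - exhausting if for every irreducible representation $\pi$ of $A$ there is $\phi\in\mathcal F$ with $\ker(\phi)\subset\ker(\pi)$; - invertibility sufficient if: (for $A$ unital) $a\in A$ is invertible if and only if $\phi(a)$ is invertible for every $\phi\in\mathcal F$; (for $A$ non-unital) for $a\in A$, the element $1+a\in A^+$ is invertible if and only if $1+\phi(a)$ is invertible for every $\phi\in\mathcal F$; - strictly norming if: (for $A$ unital) for every $a\in A$ there is $\phi\in\mathcal F$ with $\|a\|=\|\phi(a)\|$; (for $A$ non-unital) for every $a\in A$ and $\lambda\in\mathbb C$, either there is $\phi\in\mathcal F$ with $\|\lambda+a\|=\|\lambda+\phi(a)\|$, or $\|\lambda+a\|=|\lambda|$ (the norm of $\lambda+a$ being taken in $A^+$); - faithful if the direct sum representation $\bigoplus_{\phi\in\mathcal F}\phi$ is injective.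
   Formalization: Representations of a unital algebra A are required to preserve the unit (otherwise A = C with id ⊕ 0 on C² is exhausting but not invertibility sufficient), and the zero algebra is counted as non-unital. *)

(* Defs.v *)
From HB Require Import structures.
From mathcomp Require Import all_boot all_order all_algebra.
From mathcomp Require Import complex.
From mathcomp Require Import all_classical all_reals.
From mathcomp Require Import ereal esum topology normedtype.

Set Implicit Arguments.
Unset Strict Implicit.
Unset Printing Implicit Defensive.

Import Order.TTheory GRing.Theory Num.Theory.
Import numFieldNormedType.Exports.
Local Open Scope classical_set_scope.
Local Open Scope ring_scope.
Local Open Scope complex_scope.

(* The MathComp ring structures all carry a unit, hence the product of a
   possibly non-unital algebra is a plain operation here. *)
HB.mixin Record isCstarAlgebra (R : realType) A
    & CompleteNormedModule R[i] A := {
  cmul : A -> A -> A;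
  cstar : A -> A;
  cmulA : associative cmul;
  cmulDl : left_distributive cmul +%R;
  cmulDr : right_distributive cmul +%R;
  cmulZl : forall (l : R[i]) (a b : A), cmul (l *: a) b = l *: cmul a b;
  cmulZr : forall (l : R[i]) (a b : A), cmul a (l *: b) = l *: cmul a b;
  cstarK : involutive cstar;
  cstarD : {morph cstar : a b / a + b};
  cstarZ : forall (l : R[i]) (a : A), cstar (l *: a) = l^*%C *: cstar a;
  cstarM : forall a b : A, cstar (cmul a b) = cmul (cstar b) (cstar a);
  ler_normcM : forall a b : A, `|cmul a b| <= `|a| * `|b|;
  normc_cstarM : forall a : A, `|cmul (cstar a) a| = `|a| ^+ 2
}.

#[short(type="cstarAlgType")]
HB.structure Definition CstarAlgebra (R : realType) :=
  {A of CompleteNormedModule R[i] A & isCstarAlgebra R A}.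

HB.mixin Record isHilbert (R : realType) H
    & CompleteNormedModule R[i] H := {
  inner : H -> H -> R[i];
  innerDl : forall x y z : H, inner (x + y) z = inner x z + inner y z;
  innerZl : forall (l : R[i]) (x y : H), inner (l *: x) y = l * inner x y;
  innerC : forall x y : H, inner y x = (inner x y)^*%C;
  inner_norm : forall x : H, inner x x = `|x| ^+ 2
}.

#[short(type="hilbertType")]
HB.structure Definition Hilbert (R : realType) :=
  {H of CompleteNormedModule R[i] H & isHilbert R H}.

Section operators.
Variables (R : realType) (V : normedModType R[i]).
Implicit Types (T : V -> V) (x : V).

Definition is_bounded_op T :=
  linear T /\ exists M : R[i], forall x, `|T x| <= M * `|x|.

(* Library norms take values in [R[i]]; [Re] only transports the values
   [`|T x|], which are nonnegative reals, to [R], where [sup] is available. *)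
Definition opnorm T : R[i] :=
  (sup [set complex.Re `|T x| | x in [set x | `|x| <= 1]])%:C.

Definition op_invertible T :=
  exists S : V -> V, [/\ is_bounded_op S, cancel T S & cancel S T].

Definition is_subspace (W : set V) :=
  [/\ W 0, forall x y, W x -> W y -> W (x + y)
    & forall (l : R[i]) x, W x -> W (l *: x)].

Let rnorm x : (complex.Re `|x|)%:C = `|x|.
Proof. by rewrite RRe_real// ger0_real. Qed.

Lemma opnorm_le T (M : R[i]) : 0 <= M -> T 0 = 0 ->
  (forall x, `|x| <= 1 -> `|T x| <= M) -> opnorm T <= M.
Proof.
move=> M0 T0 TM; rewrite /opnorm.
have MR : (complex.Re M)%:C = M by rewrite RRe_real// ger0_real.
rewrite -MR lecR; apply: ge_sup => [|_ [x /= x1 <-]].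
  by exists (complex.Re `|T 0|), 0 => //=; rewrite normr0 ler01.
by rewrite -lecR MR rnorm; exact: TM.
Qed.

Lemma opnorm_ge T x (M : R[i]) : 0 <= M ->
  (forall x, `|x| <= 1 -> `|T x| <= M) -> `|x| <= 1 -> `|T x| <= opnorm T.
Proof.
move=> M0 TM x1; rewrite /opnorm -rnorm lecR; apply: ub_le_sup; last by exists x.
exists (complex.Re M) => _ [y /= y1 <-]; rewrite -lecR rnorm.
by rewrite RRe_real ?ger0_real//; exact: TM.
Qed.

Lemma opnormP T x (M : R[i]) : 0 <= M ->
  (forall (l : R[i]) x, T (l *: x) = l *: T x) ->
  (forall x, `|x| <= 1 -> `|T x| <= M) -> `|T x| <= opnorm T * `|x|.
Proof.
move=> M0 TZ TM; have [->|x0] := eqVneq x 0.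
  by rewrite -(scale0r (0 : V)) TZ !scale0r !normr0 mulr0.
have nx : 0 < `|x| by rewrite normr_gt0.
rewrite -ler_pdivrMr// mulrC -[leLHS]ger0_norm; last first.
  by rewrite mulr_ge0// invr_ge0.
rewrite normrM normr_id normrV ?unitfE ?gt_eqF// normr_id.
have -> : `|x|^-1 * `|T x| = `|T (`|x|^-1 *: x)|.
  by rewrite TZ normrZ ger0_norm// invr_ge0.
by apply: opnorm_ge M0 TM _; rewrite normfZV.
Qed.

End operators.

Section cstar_algebra.
Variables (R : realType) (A : cstarAlgType R).
Implicit Types a b e : A.

(* The zero algebra, whose [0] is neutral, counts as non-unital. *)
Definition is_unit e :=
  e != 0 /\ forall a, cmul e a = a /\ cmul a e = a.

Definition unital := exists e, is_unit e.

Definition invertible e a := exists b, cmul a b = e /\ cmul b a = e.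

Lemma cmul0l a : cmul 0 a = 0.
Proof. by have := cmulZl 0 0 a; rewrite !scale0r. Qed.

Lemma cmul0r a : cmul a 0 = 0.
Proof. by have := cmulZr 0 a 0; rewrite !scale0r. Qed.

Lemma cstar0 : cstar (0 : A) = 0.
Proof. by have := cstarZ 0 (0 : A); rewrite rmorph0 !scale0r. Qed.

Lemma norm_cstar a : `|cstar a| = `|a|.
Proof.
have le c : `|c| <= `|cstar c|.
  have [->|c0] := eqVneq c 0; first by rewrite normr0.
  rewrite -(ler_pM2r (_ : 0 < `|c|)) ?normr_gt0// -expr2 -normc_cstarM.
  exact: ler_normcM.
by apply/eqP; rewrite eq_le le andbT -[leRHS](congr1 _ (cstarK a)) le.
Qed.

End cstar_algebra.
Arguments unital {R} A.

Section complex_complete.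
Variable R : realType.

Lemma normc_ge_Im (z : R[i]) : `|complex.Im z|%:C <= `|z|.
Proof.
have := normc_ge_Re (z * 'i); rewrite ReiNIm normrN normrM.
by rewrite [`|'i|](_ : _ = 1) ?mulr1// normc_def/= expr0n expr1n add0r sqrtr1.
Qed.

Lemma complex_complete (F : set_system R[i]^o) :
  ProperFilter F -> cauchy F -> cvg F.
Proof.
move=> FF /cauchyP Fc.
have cauchyf (f : R[i] -> R) : (forall z w : R[i],
    `|f z - f w|%:C <= `|z - w|) -> cvg (f @ F).
  move=> fle; apply: cauchy_cvg; apply/cauchy_exP => e e0.
  have [|z Fz] := Fc e%:C; first by rewrite ltcR.
  exists (f z); rewrite /nbhs/=; apply: filterS Fz => w.
  by rewrite -!ball_normE/= => zw; rewrite -ltcR; exact: le_lt_trans (fle _ _) zw.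
have /cvg_ex[x Fx] : cvg (@complex.Re R @ F).
  by apply: cauchyf => z w; rewrite -raddfB/= normc_ge_Re.
have /cvg_ex[y Fy] : cvg (@complex.Im R @ F).
  by apply: cauchyf => z w; rewrite -raddfB/= normc_ge_Im.
apply/cvg_ex; exists (x +i* y); apply/cvgrPdist_le => /= e e0.
have eR : (complex.Re e)%:C = e by rewrite RRe_real// gtr0_real.
have e2 : 0 < complex.Re e / 2 by rewrite divr_gt0// -ltcR eR.
have xyE (z : R[i]) :
    x +i* y - z = (x - complex.Re z)%:C + 'i * (y - complex.Im z)%:C.
  by case: z => ? ?; simpc.
near=> z; rewrite xyE.
apply: le_trans (ler_normD _ _) _.
rewrite normrM [`|'i|](_ : _ = 1) ?mul1r; last first.
  by rewrite normc_def/= expr0n expr1n add0r sqrtr1.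
have nC (r : R) : `|r%:C| = `|r|%:C.
  by rewrite normc_def/= expr0n addr0 sqrtr_sqr.
rewrite !nC -rmorphD -eR lecR [leRHS]splitr lerD//.
- by near: z; move/cvgrPdist_le : Fx; exact.
- by near: z; move/cvgrPdist_le : Fy; exact.
Unshelve. all: by end_near. Qed.

End complex_complete.

(* [(a, l)] stands for [l + a]. *)
Definition unitization (R : realType) (A : cstarAlgType R) : Type :=
  (A * R[i]^o)%type.

HB.instance Definition _ (R : realType) (A : cstarAlgType R) :=
  GRing.Lmodule.copy (unitization A) (A * R[i]^o)%type.

Section unitization.
Variables (R : realType) (A : cstarAlgType R).
Notation Ap := (unitization A).
Implicit Types (x y z : Ap) (a b : A) (l : R[i]).

Definition adj a l : Ap := (a, l).

Definition unit_mul x y : Ap :=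
  adj (cmul x.1 y.1 + x.2 *: y.1 + y.2 *: x.1) (x.2 * y.2).

Definition unit_star x : Ap := adj (cstar x.1) (x.2)^*%C.

Definition unit_act x b : A := cmul x.1 b + x.2 *: b.

(* The operator norm of left multiplication on the ideal [A] of [A^+] is the
   C*-norm of [A^+] when [A] has no unit and is nonzero. The maximum with [|l|]
   changes nothing then, and gives a complete C*-norm for every [A]. *)
Definition unit_norm x : R[i] := Num.max (opnorm (unit_act x)) `|x.2|.

Lemma unit_actDl x y b : unit_act (x + y) b = unit_act x b + unit_act y b.
Proof. by rewrite /unit_act/= cmulDl scalerDl addrACA. Qed.

Lemma unit_actZl l x b : unit_act (l *: x) b = l *: unit_act x b.
Proof. by rewrite /unit_act/= cmulZl scalerDr scalerA. Qed.

Lemma unit_actZr l x b : unit_act x (l *: b) = l *: unit_act x b.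
Proof. by rewrite /unit_act/= cmulZr scalerDr !scalerA mulrC. Qed.

Lemma unit_act0 x : unit_act x 0 = 0.
Proof. by rewrite /unit_act cmul0r scaler0 addr0. Qed.

Lemma unit_actM x y b : unit_act (unit_mul x y) b = unit_act x (unit_act y b).
Proof.
rewrite /unit_act/= !cmulDl !cmulDr !cmulZl !cmulZr !scalerDr !scalerA cmulA.
by rewrite -!addrA; congr (_ + _); exact: addrCA.
Qed.

Lemma unit_act_bound x b : `|b| <= 1 -> `|unit_act x b| <= `|x.1| + `|x.2|.
Proof.
move=> b1; rewrite (le_trans (ler_normD _ _))// lerD//.
  by rewrite (le_trans (ler_normcM _ _))// ler_piMr.
by rewrite normrZ ler_piMr.
Qed.

Lemma opnorm_act_ge0 x : 0 <= opnorm (unit_act x).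
Proof.
rewrite -[leLHS](normr0 A) -(unit_act0 x).
apply: (opnorm_ge _ (@unit_act_bound x)); first by rewrite addr_ge0.
by rewrite normr0.
Qed.

Lemma opnorm_act_le x b : `|unit_act x b| <= opnorm (unit_act x) * `|b|.
Proof.
apply: (@opnormP _ _ _ _ (`|x.1| + `|x.2|)); first by rewrite addr_ge0.
  by move=> l c; rewrite unit_actZr.
exact: unit_act_bound.
Qed.

Lemma unit_norm_le x (M : R[i]) :
  (unit_norm x <= M) = (opnorm (unit_act x) <= M) && (`|x.2| <= M).
Proof.
by rewrite comparable_ge_max// real_comparable ?ger0_real ?opnorm_act_ge0.
Qed.

Lemma unit_norm_ler x (M : R[i]) : (forall b, `|unit_act x b| <= M * `|b|) ->
  `|x.2| <= M -> unit_norm x <= M.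
Proof.
move=> h xM; have M0 : 0 <= M by exact: le_trans xM.
rewrite unit_norm_le xM andbT; apply: opnorm_le => //; first exact: unit_act0.
by move=> b b1; rewrite (le_trans (h b))// ler_piMr.
Qed.

Lemma unit_norm_ge2 x : `|x.2| <= unit_norm x.
Proof. by have := lexx (unit_norm x); rewrite {1}unit_norm_le => /andP[]. Qed.

Lemma unit_norm_ge0 x : 0 <= unit_norm x.
Proof. exact: le_trans (unit_norm_ge2 x). Qed.

Lemma unit_act_le x b : `|unit_act x b| <= unit_norm x * `|b|.
Proof.
rewrite (le_trans (opnorm_act_le _ _))// ler_wpM2r//.
by have := lexx (unit_norm x); rewrite {1}unit_norm_le => /andP[].
Qed.

Lemma ler_unit_normD x y : unit_norm (x + y) <= unit_norm x + unit_norm y.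
Proof.
apply: unit_norm_ler => [b|].
  by rewrite unit_actDl (le_trans (ler_normD _ _))// mulrDl lerD// unit_act_le.
by rewrite (le_trans (ler_normD _ _))// lerD// unit_norm_ge2.
Qed.

Lemma unit_normZ l x : unit_norm (l *: x) = `|l| * unit_norm x.
Proof.
have le k z : unit_norm (k *: z) <= `|k| * unit_norm z.
  apply: unit_norm_ler => [b|].
    by rewrite unit_actZl normrZ -mulrA ler_wpM2l// unit_act_le.
  by rewrite normrM ler_wpM2l// unit_norm_ge2.
apply/eqP; rewrite eq_le le/=; have [->|l0] := eqVneq l 0.
  by rewrite normr0 mul0r unit_norm_ge0.
rewrite -[in leLHS](scale1r x) -(mulVf l0) -scalerA.
apply: le_trans (_ : `|l| * (`|l^-1| * unit_norm (l *: x)) <= _).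
  by rewrite ler_wpM2l.
by rewrite mulrA normfV divff ?normr_eq0// mul1r.
Qed.

Lemma unit_norm_adj a : unit_norm (adj a 0) = `|a|.
Proof.
have act0 b : unit_act (adj a 0) b = cmul a b.
  by rewrite /unit_act/= scale0r addr0.
apply/eqP; rewrite eq_le unit_norm_ler//=; last 2 first.
- by move=> b; rewrite act0 ler_normcM.
- by rewrite normr0.
have [->|a0] := eqVneq a 0; first by rewrite normr0 unit_norm_ge0.
have /= := unit_act_le (adj a 0) (cstar a).
rewrite act0 -{1}(cstarK a) normc_cstarM norm_cstar.
by rewrite expr2 ler_pM2r// normr_gt0.
Qed.

Lemma unit_norm0_eq0 x : unit_norm x = 0 -> x = 0.
Proof.
case: x => a l x0; have := unit_norm_ge2 (a, l); rewrite x0 normr_le0/= => /eqP l0.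
by subst l; move: x0; rewrite unit_norm_adj => /normr0_eq0->.
Qed.

End unitization.

HB.instance Definition _ (R : realType) (A : cstarAlgType R) :=
  Lmodule_isNormed.Build R[i] (unitization A)
    (@ler_unit_normD R A) (@unit_normZ R A) (@unit_norm0_eq0 R A).

Section unitization_cstar.
Variables (R : realType) (A : cstarAlgType R).
Notation Ap := (unitization A).
Implicit Types (x y z : Ap) (a b : A) (l : R[i]).

Lemma unit_normE x : `|x| = unit_norm x. Proof. by []. Qed.

Lemma norm_adj a l : `|adj a l : Ap| <= `|a| + `|l|.
Proof.
have -> : adj a l = adj a 0 + l *: adj 0 1 :> Ap.
  by congr pair; rewrite /= ?scaler0 ?addr0 ?add0r//; exact/esym/mulr1.
rewrite (le_trans (ler_normD _ _))// lerD//; first by rewrite unit_normE unit_norm_adj.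
rewrite normrZ ler_piMr// unit_normE unit_norm_ler//= ?normr1// => b.
by rewrite /unit_act/= cmul0l add0r scale1r mul1r.
Qed.

Lemma unitization_complete (F : set_system Ap) :
  ProperFilter F -> cauchy F -> cvg F.
Proof.
move=> FF /cauchyP Fc.
have /cvg_ex[l Fl] : cvg ((snd : Ap -> R[i]^o) @ F).
  apply: complex_complete; apply/cauchy_exP => e e0.
  have [x Fx] := Fc e e0; exists x.2; rewrite /nbhs/=; apply: filterS Fx => y.
  rewrite -!ball_normE/= => xy; apply: le_lt_trans xy.
  exact: (unit_norm_ge2 (x - y)).
have /cvg_ex[a Fa] : cvg ((fst : Ap -> A) @ F).
  apply: cauchy_cvg; apply/cauchy_exP => e e0.
  have e2 : 0 < e / 2 by rewrite divr_gt0.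
  have [x Fx] := Fc _ e2; exists x.1; rewrite /nbhs/=; apply: filterS Fx => y.
  rewrite -!ball_normE/= => xy; rewrite -unit_norm_adj -unit_normE.
  have -> : adj (x.1 - y.1) 0 = (x - y) - (x.2 - y.2) *: adj 0 1 :> Ap.
    by congr pair; rewrite /= ?scaler0 ?subr0//; apply/esym/eqP;
      rewrite subr_eq0; apply/eqP/esym/mulr1.
  rewrite (le_lt_trans (ler_normB _ _))// [ltRHS]splitr ltrD// normrZ.
  have n1 : `|adj 0 1 : Ap| <= 1 by rewrite (le_trans (norm_adj _ _))// normr0 add0r normr1.
  by rewrite (le_lt_trans _ xy)// (le_trans _ (unit_norm_ge2 (x - y)))// ler_piMr.
apply/cvg_ex; exists (adj a l); apply/cvgrPdist_le => /= e e0.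
have e2 : 0 < e / 2 by rewrite divr_gt0.
near=> x; apply: le_trans (norm_adj (a - x.1) (l - x.2)) _.
rewrite [leRHS]splitr lerD//.
- by near: x; move/cvgrPdist_le : Fa; exact.
- by near: x; move/cvgrPdist_le : Fl; exact.
Unshelve. all: by end_near. Qed.

HB.instance Definition _ := Uniform_isComplete.Build Ap unitization_complete.

Lemma unit_pairP x y : x.1 = y.1 -> x.2 = y.2 -> x = y.
Proof. by case: x y => [? ?] [? ?] /= -> ->. Qed.

Lemma unit_mulA : associative (@unit_mul R A).
Proof.
move=> x y z; apply: unit_pairP; last exact: mulrA.
rewrite /= !cmulDl !cmulDr !cmulZl !cmulZr !scalerDr !scalerA cmulA.
rewrite [z.2 * x.2]mulrC [z.2 * y.2]mulrC [y.2 * z.2]mulrC !addrA.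
by rewrite [LHS](+%R.[ACl 1*4*2*5*3*6*7]).
Qed.

Lemma unit_mulDl : left_distributive (@unit_mul R A) +%R.
Proof.
move=> x y z; apply: unit_pairP; last exact: mulrDl.
rewrite /= !cmulDl scalerDl scalerDr !addrA.
by rewrite [LHS](+%R.[ACl 1*3*5*2*4*6]).
Qed.

Lemma unit_mulDr : right_distributive (@unit_mul R A) +%R.
Proof.
move=> x y z; apply: unit_pairP; last exact: mulrDr.
rewrite /= !cmulDr scalerDl scalerDr !addrA.
by rewrite [LHS](+%R.[ACl 1*3*5*2*4*6]).
Qed.

Lemma unit_mulZl l x y : unit_mul (l *: x) y = l *: unit_mul x y.
Proof.
apply: unit_pairP; last exact/esym/mulrA.
by rewrite /= cmulZl !scalerDr !scalerA [y.2 * l]mulrC.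
Qed.

Lemma unit_mulZr l x y : unit_mul x (l *: y) = l *: unit_mul x y.
Proof.
apply: unit_pairP; last exact: mulrCA.
by rewrite /= cmulZr !scalerDr !scalerA [x.2 * l]mulrC.
Qed.

Lemma unit_starK : involutive (@unit_star R A).
Proof. by move=> x; apply: unit_pairP; rewrite /= ?cstarK ?conjcK. Qed.

Lemma unit_starD : {morph (@unit_star R A) : x y / x + y}.
Proof. by move=> x y; apply: unit_pairP; rewrite /= ?cstarD ?rmorphD. Qed.

Lemma unit_starZ l x : unit_star (l *: x) = l^*%C *: unit_star x.
Proof. by apply: unit_pairP; [rewrite /= cstarZ|exact: rmorphM]. Qed.

Lemma unit_starM x y : unit_star (unit_mul x y) =
  unit_mul (unit_star y) (unit_star x).
Proof.
apply: unit_pairP; last by rewrite /= rmorphM mulrC.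
by rewrite /= !cstarD !cstarZ cstarM addrAC.
Qed.

Lemma unit_normM x y : `|unit_mul x y| <= `|x| * `|y|.
Proof.
apply: unit_norm_ler => [b|]; last by rewrite normrM ler_pM// unit_norm_ge2.
rewrite unit_actM (le_trans (unit_act_le _ _))// -mulrA.
rewrite ler_wpM2l ?unit_norm_ge0//.
exact: unit_act_le.
Qed.

Lemma unit_norm_starM x : `|unit_mul (unit_star x) x| = `|x| ^+ 2.
Proof.
set n := `|unit_mul _ _|.
have le z : `|z| ^+ 2 <= `|unit_mul (unit_star z) z|.
  set m := `|unit_mul _ _|; have m0 : 0 <= m by exact: normr_ge0.
  rewrite -(sqrtCK m) ler_sqr ?nnegrE ?sqrtC_ge0//; apply: unit_norm_ler => [b|].
    rewrite -ler_sqr ?nnegrE ?mulr_ge0 ?sqrtC_ge0// exprMn sqrtCK -normc_cstarM.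
    have -> : cmul (cstar (unit_act z b)) (unit_act z b) =
        cmul (cstar b) (unit_act (unit_mul (unit_star z) z) b).
      rewrite unit_actM {1 3}/unit_act cstarD cstarZ cstarM cmulDl cmulZl.
      by rewrite [RHS]cmulDr [in RHS]cmulZr [in RHS]cmulA.
    rewrite (le_trans (ler_normcM _ _))// norm_cstar mulrC expr2 mulrA.
    by rewrite ler_wpM2r// unit_act_le.
  rewrite -ler_sqr ?nnegrE ?sqrtC_ge0// sqrtCK.
  apply: le_trans (unit_norm_ge2 _); rewrite /= normrM.
  by rewrite expr2 [`|_^*%C|](_ : _ = `|z.2|)//; case: (z.2) => u v;
    rewrite !normc_def/= sqrrN.
have norm_star z : `|z| <= `|unit_star z|.
  have [->|z0] := eqVneq z 0; first by rewrite normr0.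
  rewrite -(ler_pM2r (_ : 0 < `|z|)) ?normr_gt0// -expr2.
  exact: le_trans (le z) (unit_normM _ _).
apply/eqP; rewrite eq_le le andbT (le_trans (unit_normM _ _))//.
by rewrite expr2 ler_wpM2r// (le_trans (norm_star _))// unit_starK.
Qed.

HB.instance Definition _ := isCstarAlgebra.Build R Ap
  unit_mulA unit_mulDl unit_mulDr unit_mulZl unit_mulZr
  unit_starK unit_starD unit_starZ unit_starM unit_normM unit_norm_starM.

End unitization_cstar.

Lemma unitization_unit (R : realType) (A : cstarAlgType R) :
  is_unit (adj 0 1 : unitization A).
Proof.
split=> [|x]; first by apply/eqP => -[/eqP]; rewrite oner_eq0.
by split; apply: unit_pairP => /=;
  rewrite ?cmul0l ?cmul0r ?scaler0 ?scale1r ?mul1r ?mulr1 ?addr0 ?add0r.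
Qed.

Section representations.
Variables (R : realType) (A : cstarAlgType R).

Definition adjoint (H : hilbertType R) (T S : H -> H) :=
  forall x y, inner (T x) y = inner x (S y).

(* Representations of a unital algebra preserve the unit: otherwise, adding a
   zero summand to a representation would destroy the invertibility of its
   operators. For non-unital algebras, degenerate representations are
   allowed. *)
Record representation := Representation {
  rep_space : hilbertType R;
  rep_op :> A -> rep_space -> rep_space;
  rep_bounded : forall a, is_bounded_op (rep_op a);
  rep_linear : forall (l : R[i]) a b x,
    rep_op (l *: a + b) x = l *: rep_op a x + rep_op b x;
  rep_mul : forall a b x, rep_op (cmul a b) x = rep_op a (rep_op b x);
  rep_star : forall a, adjoint (rep_op a) (rep_op (cstar a));
  rep_unit : forall e, is_unit e -> forall x, rep_op e x = x
}.

Implicit Types phi pi : representation.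

Definition rep_ker phi : set A := [set a | forall x, phi a x = 0].

Definition irreducible pi :=
  (exists a x, pi a x != 0) /\
  forall W : set (rep_space pi), is_subspace W -> closed W ->
    (forall a x, W x -> W (pi a x)) -> W = [set 0] \/ W = setT.

(* [representation] lives in a universe too high for [set], so a set of
   representations is given as a family. *)
Section families.
Variables (I : choiceType) (F : I -> representation).

Definition exhausting :=
  forall pi, irreducible pi -> exists i, rep_ker (F i) `<=` rep_ker pi.

Definition invertibility_sufficient :=
  (forall e : A, is_unit e -> forall a,
     invertible e a <-> forall i, op_invertible (F i a)) /\
  (~ unital A -> forall a,
     invertible (adj 0 1 : unitization A) (adj a 1) <->
     forall i, op_invertible (fun x => x + F i a x)).

Definition strictly_norming :=
  (unital A -> forall a, exists i, `|a| = opnorm (F i a)) /\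
  (~ unital A -> forall a (l : R[i]),
     (exists i, `|adj a l : unitization A| =
        opnorm (fun x => l *: x + F i a x)) \/
     `|adj a l : unitization A| = `|l|).

Definition hilbert_sum : Type :=
  {xi : forall i, rep_space (F i) |
    (\esum_(i in [set: I]) ((complex.Re `|xi i|) ^+ 2)%:E < +oo)%E}.

(* As *-morphisms are contractive, the image is again square-summable; this
   is irrelevant for injectivity and not recorded in the type, so that the
   definition needs no proof of contractivity. *)
Definition direct_sum (a : A) (xi : hilbert_sum) :
    forall i, rep_space (F i) :=
  fun i => F i a (sval xi i).

Definition faithful := injective direct_sum.

End families.
End representations.

(* Main.v *)
(* Both implications out of "exhausting" rest on one separation principle: if
   [y] lies in a unital C*-algebra [B] and [y^* y] is not bounded below by a
   positive multiple of the unit, then some pure state [f] has [f (y^* y) = 0],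
   so the cyclic vector of its irreducible GNS representation [pi] is killed by
   [pi y]. If [ker phi] is contained in [ker pi], then [phi y] cannot be bounded
   below either: otherwise [phi (y^* y - d)] is positive for some [d > 0], hence
   [phi], and with it [pi], kills the negative part of [y^* y - d], giving
   [f (y^* y - d) >= 0]. Apply this to [y = a] and [y = a^*] when [a] is not
   invertible, and to [y = sqrt (|a|^2 - a^* a)] for the norm. For non-unital
   [A] work in [B = A^+] and restrict [pi] to [A].

   Positivity is developed without spectra: a self-adjoint [a] is positive when
   [|r - a| <= r] for some [r > 0], and square roots come from an iteration.
   The pure state is a minimal element among the sublinear functionals that
   support a face of states vanishing at [y^* y]. *)
Require Import Defs.
From HB Require Import structures.
From mathcomp Require Import all_boot all_order all_algebra.
From mathcomp Require Import complex.
From mathcomp Require Import all_classical all_reals.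
From mathcomp Require Import ereal esum topology normedtype sequences.
From mathcomp Require Import ring.

Set Implicit Arguments.
Unset Strict Implicit.
Unset Printing Implicit Defensive.

Import Order.TTheory GRing.Theory Num.Theory.
Import numFieldNormedType.Exports.
Local Open Scope classical_set_scope.
Local Open Scope ring_scope.
Local Open Scope complex_scope.

(** A kernel inclusion transports equations, not inequalities. So a lower bound for [phi y] has to
    be encoded as the vanishing of an element, and the negative part of [y^* y - d] is that element.
    Minimality replaces the usual chain of Banach-Alaoglu, Hahn-Banach and Krein-Milman: passing to
    a one-sided derivative stays inside the ordered set, so a single use of Zorn's lemma gives a
    functional that is both linear and pure. For [A^+] the hypothesis only concerns irreducible
    representations of [A], and a GNS representation of [A^+] could vanish on [A]. The scalar part
    of [y] decides: when it is nonzero, [pi y xi = 0] puts the cyclic vector [xi] into [A xi]. For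
    [1 + a] and its adjoint it is 1; for the norm of [l + a] it is 0 exactly when [|l + a| = |l|],
    the exceptional alternative in the definition of strictly norming. *)

Local Notation "a ** b" := (cmul a b) (at level 40, left associativity).

(** * Algebra in a C*-algebra *)

Section complex_normed.
Variables (R : realType).
Implicit Types V : normedModType R[i].

Lemma cplx_real_gt0 (r : R[i]) : 0 < r -> exists2 q : R, 0 < q & r = q%:C.
Proof.
move=> r0; exists (complex.Re r); last by rewrite RRe_real// gtr0_real.
by rewrite -ltcR RRe_real// gtr0_real.
Qed.

Lemma conjc_i : 'i^*%C = - 'i :> R[i].
Proof. by apply/eqP; rewrite eq_complex /= oppr0 !eqxx. Qed.

Lemma conjc_ge0 (r : R[i]) : 0 <= r -> r^*%C = r.
Proof. by move=> r0; apply/CrealP; exact: ger0_real. Qed.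

Lemma norm_cvg_le V (u : nat -> V) (l : V) (M : R[i]) :
  u @ \oo --> l -> (forall n, `|u n| <= M) -> `|l| <= M.
Proof.
move=> ul uM; apply/ler_addgt0Pl => d d0.
move/cvgrPdist_le : ul => /(_ _ d0) [N _ /(_ N (leqnn N))] /= lN.
by rewrite -(subrK (u N) l) (le_trans (ler_normD _ _))// lerD.
Qed.

(** The increments of [s] are nonnegative, so [s] converges, and telescoped they dominate those of
    [u]. The square root iteration and the Neumann series both converge this way. *)
Lemma cvg_majorant (V : completeNormedModType R[i]) (u : nat -> V)
    (s : nat -> R) (M : R) :
  (forall n, `|u n.+1 - u n| <= (s n.+1 - s n)%:C) -> (forall n, s n <= M) ->
  cvg (u @ \oo).
Proof.
move=> us sM.
have uds n k : `|u (n + k)%N - u n| <= (s (n + k)%N - s n)%:C.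
  elim: k => [|k ih]; first by rewrite addn0 !subrr normr0.
  rewrite addnS -(subrK (u (n + k)%N) (u _)) -addrA (le_trans (ler_normD _ _))//.
  rewrite -(subrK (s (n + k)%N) (s _)) -addrA [leRHS]rmorphD/=.
  by rewrite lerD.
have s_nd : nondecreasing_seq s.
  by apply/nondecreasing_seqP => n; rewrite -subr_ge0 -ler0c (le_trans _ (us n)).
have s_cvg : cvgn s.
  apply: nondecreasing_is_cvgn => //.
  by exists M => _ [n _ <-].
apply: cauchy_cvg; apply/cauchy_exP => _ /cplx_real_gt0[d d0 ->].
have sl : s @ \oo --> limn s by [].
move/cvgrPdist_lt : sl => /(_ _ d0) [N _ sN].
exists (u N), N => // n /= Nn; rewrite -ball_normE/= distrC.
rewrite -(subnKC Nn) (le_lt_trans (uds _ _))// ltcR subnKC//.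
have := sN N (leqnn N); rewrite /= => sN'.
rewrite (le_lt_trans _ sN')// (le_trans _ (ler_norm _))// lerB//.
exact: nondecreasing_cvgn_le.
Qed.

End complex_normed.

Section cstar_basics.
Variables (R : realType) (A : cstarAlgType R).
Implicit Types a b c : A.

Lemma cmulNl a b : (- a) ** b = - (a ** b).
Proof. by have := cmulZl (-1) a b; rewrite !scaleN1r. Qed.

Lemma cmulNr a b : a ** (- b) = - (a ** b).
Proof. by have := cmulZr (-1) a b; rewrite !scaleN1r. Qed.

Lemma cmulBl a b c : (a - b) ** c = a ** c - b ** c.
Proof. by rewrite cmulDl cmulNl. Qed.

Lemma cmulBr a b c : a ** (b - c) = a ** b - a ** c.
Proof. by rewrite cmulDr cmulNr. Qed.

Lemma cstarN a : cstar (- a) = - cstar a.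
Proof. by have := cstarZ (-1) a; rewrite rmorphN rmorph1 !scaleN1r. Qed.

Lemma cstarB a b : cstar (a - b) = cstar a - cstar b.
Proof. by rewrite cstarD cstarN. Qed.

Definition selfadjoint a := cstar a = a.
Definition commuting a b := a ** b = b ** a.

Lemma commuting_sym a b : commuting a b -> commuting b a.
Proof. exact: esym. Qed.

Lemma commutingM a b c : commuting a b -> commuting a c -> commuting a (b ** c).
Proof. by rewrite /commuting => ab ac; rewrite cmulA ab -cmulA ac cmulA. Qed.

Lemma commutingD a b c : commuting a b -> commuting a c -> commuting a (b + c).
Proof. by rewrite /commuting cmulDl cmulDr => -> ->. Qed.

Lemma commutingZ a b (l : R[i]) : commuting a b -> commuting a (l *: b).
Proof. by rewrite /commuting cmulZl cmulZr => ->. Qed.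

Lemma commutingB a b c : commuting a b -> commuting a c -> commuting a (b - c).
Proof. by rewrite /commuting cmulBl cmulBr => -> ->. Qed.

Lemma saD a b : selfadjoint a -> selfadjoint b -> selfadjoint (a + b).
Proof. by rewrite /selfadjoint cstarD => -> ->. Qed.

Lemma saB a b : selfadjoint a -> selfadjoint b -> selfadjoint (a - b).
Proof. by rewrite /selfadjoint cstarB => -> ->. Qed.

Lemma saZ a (l : R[i]) : 0 <= l -> selfadjoint a -> selfadjoint (l *: a).
Proof.
rewrite /selfadjoint cstarZ => l0 ->; by rewrite conjc_ge0.
Qed.

Lemma saM a b : selfadjoint a -> selfadjoint b -> commuting a b ->
  selfadjoint (a ** b).
Proof. by rewrite /selfadjoint cstarM => -> -> ->. Qed.

Lemma sa_starM a : selfadjoint (cstar a ** a).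
Proof. by rewrite /selfadjoint cstarM cstarK. Qed.

Lemma sa_norm a : selfadjoint a -> `|a ** a| = `|a| ^+ 2.
Proof. by move=> sa; rewrite -normc_cstarM sa. Qed.

Lemma starM_eq0 a : cstar a ** a = 0 -> a = 0.
Proof.
by move=> a0; apply/normr0_eq0/eqP; rewrite -sqrf_eq0 -normc_cstarM a0 normr0.
Qed.

Lemma sa_sq_eq0 a : selfadjoint a -> a ** a = 0 -> a = 0.
Proof. by move=> sa a0; apply: starM_eq0; rewrite sa. Qed.

(* [y + iz] is normal with [(y + iz)^* (y + iz) = y^2 + z^2]. *)
Lemma norm_sum_sq y z : selfadjoint y -> selfadjoint z -> commuting y z ->
  `|y| ^+ 2 <= `|y ** y + z ** z|.
Proof.
move=> ys zs yz; set u := y + 'i *: z.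
have us : cstar u = y - 'i *: z.
  by rewrite /u cstarD cstarZ ys zs conjc_i scaleNr.
have uu : cstar u ** u = y ** y + z ** z.
  rewrite us /u cmulBl !cmulDr !cmulZl !cmulZr yz scalerA -expr2 sqr_i scaleN1r.
  by rewrite opprD opprK addrA addrK.
have yE : y = 2^-1 *: (u + cstar u).
  rewrite us /u addrACA subrr addr0 scalerDr -scalerDl.
  by rewrite -[2^-1]div1r -splitr scale1r.
rewrite -uu normc_cstarM ler_sqr ?nnegrE// yE normrZ normfV normr_nat.
rewrite ler_pdivrMl// mulr_natl mulr2n (le_trans (ler_normD _ _))//.
by rewrite norm_cstar.
Qed.

Lemma cvg_cmul (u v : nat -> A) a b : u @ \oo --> a -> v @ \oo --> b ->
  (fun n => u n ** v n) @ \oo --> a ** b.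
Proof.
move=> ua vb; apply/cvgrPdist_le => /= d d0.
have a1 : 0 < `|a| + 1 by rewrite ltr_wpDl.
have b1 : 0 < `|b| + 1 by rewrite ltr_wpDl.
have d2 : 0 < d / 2 by rewrite divr_gt0.
near=> n.
have -> : a ** b - u n ** v n = (a - u n) ** b + u n ** (b - v n).
  by rewrite cmulBl cmulBr addrA subrK.
have xa : `|u n| <= `|a| + 1.
  rewrite -(subrK a (u n)) addrC (le_trans (ler_normD _ _))// lerD2l// distrC.
  by near: n; move/cvgrPdist_le : ua; exact.
rewrite [leRHS]splitr (le_trans (ler_normD _ _))// lerD//.
  apply: (@le_trans _ _ (d / 2 / (`|b| + 1) * (`|b| + 1))); last by rewrite divfK ?gt_eqF.
  rewrite (le_trans (ler_normcM _ _))// ler_pM// ?lerDl//.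
  by near: n; move/cvgrPdist_le : ua; apply; rewrite divr_gt0.
apply: (@le_trans _ _ ((`|a| + 1) * (d / 2 / (`|a| + 1)))); last first.
  by rewrite mulrC divfK ?gt_eqF.
rewrite (le_trans (ler_normcM _ _))// ler_pM//.
by near: n; move/cvgrPdist_le : vb; apply; rewrite divr_gt0.
Unshelve. all: by end_near. Qed.

Lemma cvg_cstar (u : nat -> A) a : u @ \oo --> a ->
  (fun n => cstar (u n)) @ \oo --> cstar a.
Proof.
move=> ua; apply/cvgrPdist_le => d d0; near=> n.
rewrite -cstarB norm_cstar; near: n; move/cvgrPdist_le : ua; exact.
Unshelve. all: by end_near. Qed.

End cstar_basics.

(** * Square roots *)

Section square_root.
Variables (R : realType) (A : cstarAlgType R).
Implicit Types a b t w : A.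

Lemma half_add a : 2^-1 *: (a + a) = a.
Proof. by rewrite scalerDr -scalerDl -[2^-1]div1r -splitr scale1r. Qed.

Lemma halfC : (2^-1)%:C = 2^-1 :> R[i].
Proof. by rewrite fmorphV rmorph_nat. Qed.

(* Visser's iteration for [s] with [(1 - s)^2 = 1 - t]. *)
Fixpoint sqrt_iter t n : A :=
  if n is m.+1 then 2^-1 *: (t + sqrt_iter t m ** sqrt_iter t m) else 0.

(** The same iteration at the scalar 1; it majorises norms and increments for every [t] of norm at
    most 1. *)
Fixpoint sqrt_iter_bound n : R :=
  if n is m.+1 then 2^-1 * (1 + sqrt_iter_bound m ^+ 2) else 0.

Lemma sqrt_iter_bound_itv n : 0 <= sqrt_iter_bound n <= 1.
Proof.
elim: n => [|n /andP[ge le]] /=; first by rewrite lexx ler01.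
apply/andP; split; first by rewrite mulr_ge0 ?addr_ge0 ?sqr_ge0 ?invr_ge0.
by rewrite ler_pdivrMl// mulr1 lerD2l expr_le1.
Qed.

Lemma norm_sqrt_iter t n : `|t| <= 1 -> `|sqrt_iter t n| <= (sqrt_iter_bound n)%:C.
Proof.
move=> t1; elim: n => [|n ih] /=; first by rewrite normr0.
rewrite normrZ normfV normr_nat rmorphM/= halfC rmorphD/= expr2 rmorphM/=.
rewrite ler_wpM2l ?invr_ge0// (le_trans (ler_normD _ _))// lerD//.
by rewrite (le_trans (ler_normcM _ _))// ler_pM.
Qed.

Lemma norm_sqrt_iterB t n : `|t| <= 1 ->
  `|sqrt_iter t n.+1 - sqrt_iter t n| <=
  (sqrt_iter_bound n.+1 - sqrt_iter_bound n)%:C.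
Proof.
move=> t1; elim: n => [|n ih].
  rewrite /= !subr0 cmul0l addr0 expr0n addr0 mulr1 normrZ normfV normr_nat.
  by rewrite halfC ler_piMr// invr_ge0.
have sE : sqrt_iter_bound n.+2 - sqrt_iter_bound n.+1 =
    2^-1 * ((sqrt_iter_bound n.+1 - sqrt_iter_bound n) *
            (sqrt_iter_bound n.+1 + sqrt_iter_bound n)).
  rewrite [sqrt_iter_bound n.+2]/= {2}[sqrt_iter_bound n.+1]/= -mulrBr -subr_sqr.
  by rewrite opprD addrACA subrr add0r.
(* Noncommutative difference of squares, matching the real one in [sE] term by term. *)
have iE : sqrt_iter t n.+2 - sqrt_iter t n.+1 = 2^-1 *:
    (sqrt_iter t n.+1 ** (sqrt_iter t n.+1 - sqrt_iter t n) +
     (sqrt_iter t n.+1 - sqrt_iter t n) ** sqrt_iter t n).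
  rewrite cmulBl cmulBr addrA subrK -/(sqrt_iter t n.+1).
  rewrite [sqrt_iter t n.+2]/= {3}[sqrt_iter t n.+1]/= -scalerBr.
  by rewrite opprD addrACA subrr add0r.
rewrite iE sE normrZ normfV normr_nat rmorphM/= halfC.
rewrite ler_wpM2l ?invr_ge0// (le_trans (ler_normD _ _))//.
rewrite mulrDr rmorphD lerD//; last first.
  by rewrite rmorphM (le_trans (ler_normcM _ _))// ler_pM// norm_sqrt_iter.
rewrite mulrC rmorphM (le_trans (ler_normcM _ _))// ler_pM//.
exact: (norm_sqrt_iter n.+1).
Qed.

Definition sqrt_lim t : A := lim (sqrt_iter t @ \oo).

Lemma cvg_sqrt_iter t : `|t| <= 1 -> sqrt_iter t @ \oo --> sqrt_lim t.
Proof.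
move=> t1; apply: (@cvg_majorant _ _ _ sqrt_iter_bound 1) => n.
  exact: norm_sqrt_iterB.
by have /andP[] := sqrt_iter_bound_itv n.
Qed.

Lemma norm_sqrt_lim t : `|t| <= 1 -> `|sqrt_lim t| <= 1.
Proof.
move=> t1; apply: norm_cvg_le (cvg_sqrt_iter t1) _ => n.
apply: le_trans (norm_sqrt_iter n t1) _.
by rewrite lecR; have /andP[] := sqrt_iter_bound_itv n.
Qed.

Lemma sqrt_limE t : `|t| <= 1 -> sqrt_lim t ** sqrt_lim t = sqrt_lim t + sqrt_lim t - t.
Proof.
move=> t1; have ct := cvg_sqrt_iter t1.
suff sE : sqrt_lim t = 2^-1 *: (t + sqrt_lim t ** sqrt_lim t).
  rewrite [in X in X + _ - _]sE [in X in _ + X - _]sE -scalerDr.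
  by rewrite half_add addrAC subrr add0r.
have ct' : (fun n => sqrt_iter t n.+1) @ \oo --> sqrt_lim t.
  by rewrite cvg_shiftS.
apply: (norm_cvg_unique ct'); apply: cvgZl_tmp; apply: cvgD; first exact: cvg_cst.
exact: cvg_cmul.
Qed.

(** Every stage of the iteration is a polynomial, so [w] intertwines it. Commutation is the case
    [t = t']; two different elements occur in [pos_starM]. *)
Lemma sqrt_lim_intertwine t t' w : `|t| <= 1 -> `|t'| <= 1 ->
  w ** t = t' ** w -> w ** sqrt_lim t = sqrt_lim t' ** w.
Proof.
move=> t1 t'1 wt.
have wi n : w ** sqrt_iter t n = sqrt_iter t' n ** w.
  elim: n => [|n ih] /=; first by rewrite cmul0l cmul0r.
  by rewrite cmulZl cmulZr cmulDr cmulDl wt cmulA ih -cmulA ih cmulA.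
have c1 : (fun n => w ** sqrt_iter t n) @ \oo --> w ** sqrt_lim t.
  by apply: cvg_cmul; [exact: cvg_cst|exact: cvg_sqrt_iter].
have c2 : (fun n => w ** sqrt_iter t n) @ \oo --> sqrt_lim t' ** w.
  under eq_fun do rewrite wi.
  by apply: cvg_cmul; [exact: cvg_sqrt_iter|exact: cvg_cst].
exact: norm_cvg_unique c1 c2.
Qed.

Lemma sqrt_lim_sa t : `|t| <= 1 -> selfadjoint t -> selfadjoint (sqrt_lim t).
Proof.
move=> t1 ts; have ct := cvg_sqrt_iter t1.
have st n : cstar (sqrt_iter t n) = sqrt_iter t n.
  elim: n => [|n ih] /=; first by rewrite cstar0.
  rewrite cstarZ cstarD cstarM ih ts conjc_ge0// invr_ge0//.
have fE : (fun n => cstar (sqrt_iter t n)) = sqrt_iter t by exact/funext.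
have := cvg_cstar ct; rewrite fE => cs.
exact: norm_cvg_unique cs ct.
Qed.

End square_root.

(** * Positive elements *)

Section positivity.
Variables (R : realType) (A : cstarAlgType R) (e : A).
Hypothesis eU : is_unit e.
Implicit Types a b w x y z : A.

Lemma cmul1l a : e ** a = a. Proof. by case: eU => _ /(_ a)[]. Qed.
Lemma cmul1r a : a ** e = a. Proof. by case: eU => _ /(_ a)[]. Qed.

Lemma sa_unit : selfadjoint e.
Proof.
have ee : cstar e ** e = cstar e by rewrite cmul1r.
by rewrite /selfadjoint -[RHS]cstarK -[in RHS]ee cstarM cstarK ee.
Qed.

Lemma norm_unit : `|e| = 1.
Proof.
have e0 : `|e| != 0 by rewrite normr_eq0; case: eU.
by apply: (mulfI e0); rewrite mulr1 -expr2 -sa_norm ?cmul1r//; exact: sa_unit.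
Qed.

Lemma commuting1 a : commuting a e.
Proof. by rewrite /commuting cmul1l cmul1r. Qed.

(* On self-adjoint elements this means that the spectrum is nonnegative; the
   norm condition makes the cone property immediate. *)
Definition pos a := selfadjoint a /\ exists2 r : R[i], 0 < r & `|r *: e - a| <= r.

Lemma pos_le a (r r' : R[i]) : r <= r' -> `|r *: e - a| <= r -> `|r' *: e - a| <= r'.
Proof.
move=> rr ra; rewrite -(subrK (r *: e) (r' *: e)) -scalerBl -addrA.
rewrite (le_trans (ler_normD _ _))// normrZ norm_unit mulr1 ger0_norm ?subr_ge0//.
by rewrite -[leRHS](subrK r) lerD2l.
Qed.

Lemma posD a b : pos a -> pos b -> pos (a + b).
Proof.
move=> [sa [r r0 ra]] [sb [q q0 qb]]; split; first exact: saD.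
exists (r + q); first exact: addr_gt0.
rewrite scalerDl opprD addrACA (le_trans (ler_normD _ _))//.
exact: lerD.
Qed.

Lemma pos0 : pos 0.
Proof.
split; first exact: cstar0.
by exists 1 => //; rewrite scale1r subr0 norm_unit.
Qed.

Lemma posZ (l : R[i]) a : 0 <= l -> pos a -> pos (l *: a).
Proof.
rewrite le_eqVlt => /predU1P[<- _|l0]; first by rewrite scale0r; exact: pos0.
move=> [sa [r r0 ra]]; split; first exact: saZ (ltW l0) sa.
exists (l * r); first exact: mulr_gt0.
by rewrite -scalerA -scalerBr normrZ gtr0_norm// ler_pM2l.
Qed.

Lemma pos1 : pos e.
Proof.
split; first exact: sa_unit.
by exists 1 => //; rewrite scale1r subrr normr0.
Qed.

Lemma pos_norm_sub a : selfadjoint a -> pos (`|a| *: e - a).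
Proof.
move=> sa; split; first by apply: saB => //; apply: saZ => //; exact: sa_unit.
exists (`|a| + 1); first by rewrite ltr_wpDl.
rewrite scalerDl scale1r opprB addrC subrKA (le_trans (ler_normD _ _))//.
by rewrite norm_unit.
Qed.

(** If [|r e - a| <= r], then [t = e - a / r] is in the unit ball and [e - sqrt_lim t] is a root of
    [a / r]. Independence of [r] only comes with [pos_sq_inj]. *)
Definition sqrt_scale (r : R[i]) a : A :=
  sqrtC r *: (e - sqrt_lim (e - r^-1 *: a)).

Section sqrt_scale.
Variables (r : R[i]) (r0 : 0 < r).

Lemma norm_scale_le1 a : `|r *: e - a| <= r -> `|e - r^-1 *: a| <= 1.
Proof.
move=> ra; have -> : e - r^-1 *: a = r^-1 *: (r *: e - a).
  by rewrite scalerBr scalerA mulVf ?gt_eqF// scale1r.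
by rewrite normrZ normfV gtr0_norm// ler_pdivrMl// mulr1.
Qed.

Lemma sqrt_scale_sa a : selfadjoint a -> `|r *: e - a| <= r ->
  selfadjoint (sqrt_scale r a).
Proof.
move=> sa ra; apply: saZ; first by rewrite sqrtC_ge0 ltW.
apply: saB; first exact: sa_unit.
apply: sqrt_lim_sa; first exact: norm_scale_le1.
by apply: saB; [exact: sa_unit|apply: saZ => //; rewrite invr_ge0 ltW].
Qed.

Lemma pos_sqrt_scale a : selfadjoint a -> `|r *: e - a| <= r ->
  pos (sqrt_scale r a).
Proof.
move=> sa ra; split; first exact: sqrt_scale_sa.
exists (sqrtC r); first by rewrite sqrtC_gt0.
have sr0 : 0 <= sqrtC r by rewrite sqrtC_ge0 ltW.
rewrite -scalerBr subKr normrZ ger0_norm// ler_piMr//.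
by rewrite norm_sqrt_lim// norm_scale_le1.
Qed.

Lemma sqrt_scale_sq a : `|r *: e - a| <= r ->
  sqrt_scale r a ** sqrt_scale r a = a.
Proof.
move=> ra; rewrite cmulZl cmulZr scalerA -expr2 sqrtCK cmulBl !cmulBr.
rewrite sqrt_limE ?norm_scale_le1// !cmul1l cmul1r.
set s := sqrt_lim _.
have -> : e - s - (s - (s + s - (e - r^-1 *: a))) = r^-1 *: a.
  set u := e - _ *: _; have -> : s - (s + s - u) = u - s.
    by rewrite opprB addrCA opprD addNKr.
  by rewrite opprB addrA subrK subKr.
by rewrite scalerA divff ?gt_eqF// scale1r.
Qed.

Lemma sqrt_scale_intertwine a b w : `|r *: e - a| <= r -> `|r *: e - b| <= r ->
  w ** a = b ** w -> w ** sqrt_scale r a = sqrt_scale r b ** w.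
Proof.
move=> ra rb wab; rewrite cmulZl cmulZr cmulBl cmulBr cmul1l cmul1r.
rewrite (@sqrt_lim_intertwine _ _ _ (e - r^-1 *: b)) ?norm_scale_le1//.
by rewrite cmulBr cmulBl cmul1l cmul1r cmulZl cmulZr wab.
Qed.

End sqrt_scale.

Lemma pos_sqrt x : pos x -> exists y,
  [/\ pos y, y ** y = x & forall w, commuting w x -> commuting w y].
Proof.
move=> [sx [r r0 rx]]; exists (sqrt_scale r x); split.
- exact: pos_sqrt_scale.
- exact: sqrt_scale_sq.
- by move=> w; exact: sqrt_scale_intertwine.
Qed.

(** For [t = y / r] the iteration gives a root [z] of [e - t^2], and [norm_sum_sq] yields
    [|e - t^2| = |z|^2 <= |z^2 + t^2| = 1]. *)
Lemma pos_sq_sub y (r : R[i]) : selfadjoint y -> 0 < r -> `|y| <= r ->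
  `|r ^+ 2 *: e - y ** y| <= r ^+ 2.
Proof.
move=> sy r0 yr; pose t := r^-1 *: y.
have st : selfadjoint t by apply: saZ => //; rewrite invr_ge0 ltW.
have t1 : `|t| <= 1 by rewrite normrZ normfV gtr0_norm// ler_pdivrMl// mulr1.
have tt1 : `|e - (e - t ** t)| <= 1.
  by rewrite subKr (le_trans (ler_normcM _ _))// mulr_ile1.
have tt1' : `|1 *: e - (e - t ** t)| <= 1 by rewrite scale1r.
have stt : selfadjoint (e - t ** t).
  by apply: saB; [exact: sa_unit|exact: saM].
pose z := sqrt_scale 1 (e - t ** t).
have zz : z ** z = e - t ** t by exact: sqrt_scale_sq.
have zt : commuting z t.
  apply/commuting_sym/sqrt_scale_intertwine => //.
  apply: commutingB; first exact: commuting1.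
  exact: commutingM.
have sz : selfadjoint z by exact: sqrt_scale_sa.
have := norm_sum_sq sz st zt; rewrite zz subrK norm_unit -sa_norm// zz => le1.
have -> : r ^+ 2 *: e - y ** y = r ^+ 2 *: (e - t ** t).
  rewrite /t cmulZl cmulZr [in RHS]scalerA -invfM -expr2 scalerBr scalerA.
  by rewrite divff ?scale1r// expf_neq0 ?gt_eqF.
by rewrite normrZ gtr0_norm ?exprn_gt0// ler_piMr// ltW// exprn_gt0.
Qed.

Lemma pos_sq y : selfadjoint y -> pos (y ** y).
Proof.
move=> sy; split; first exact: saM.
have r0 : 0 < `|y| + 1 by rewrite ltr_wpDl.
exists ((`|y| + 1) ^+ 2); first by rewrite exprn_gt0.
by apply: pos_sq_sub => //; rewrite lerDl.
Qed.

(** The roots [y] of [x] and [z] of [c - x] commute, so [|x| = |y|^2 <= |y^2 + z^2| = c]. *)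
Lemma pos_norm_le x (c : R[i]) : 0 <= c -> pos x -> pos (c *: e - x) -> `|x| <= c.
Proof.
move=> c0 px pcx.
have [y [[sy _] yy yc]] := pos_sqrt px.
have [z [[sz _] zz zc]] := pos_sqrt pcx.
have yz : commuting y z.
  apply: zc; apply: commutingB; first by apply: commutingZ; exact: commuting1.
  by rewrite -yy; exact: commutingM.
have := norm_sum_sq sy sz yz; rewrite yy zz addrC subrK normrZ norm_unit mulr1.
by rewrite -sa_norm// yy ger0_norm.
Qed.

Lemma pos_anti x : pos x -> pos (- x) -> x = 0.
Proof.
move=> px pnx; apply/eqP; rewrite -normr_le0.
by apply: pos_norm_le => //; rewrite scale0r sub0r.
Qed.

(** Let [d = x - y], [x = s^2], [y = q^2]. Then [s d] and [q d] are commuting self-adjoint elements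
    with [(s d)^2 + (q d)^2 = (x + y) d^2 = 0], so both vanish by [norm_sum_sq]; hence
    [x d = y d = 0] and [d^2 = 0]. *)
Lemma pos_sq_inj x y : pos x -> pos y -> commuting x y -> x ** x = y ** y -> x = y.
Proof.
move=> px py xy xxyy; have [sx _] := px; have [sy _] := py.
have [s [[ss _] s2 sc]] := pos_sqrt px.
have [q [[sq _] q2 qc]] := pos_sqrt py.
pose d := x - y; have sd : selfadjoint d by exact: saB.
have ys : commuting y s by apply: sc; exact: commuting_sym.
have xs : commuting x s by exact: sc.
have xq : commuting x q by exact: qc.
have yq : commuting y q by exact: qc.
have ds : commuting s d by apply: commutingB; exact: commuting_sym.
have dq : commuting q d by apply: commutingB; exact: commuting_sym.
have sq_q : commuting s q by apply: qc; exact: commuting_sym.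
have xyd : (x + y) ** d = 0 by rewrite cmulDl !cmulBr xy xxyy addrC subrKA subrr.
have sqM u : commuting u d -> (u ** d) ** (u ** d) = (u ** u) ** d ** d.
  by move=> ud; rewrite -!cmulA; congr (_ ** _); rewrite !cmulA ud.
have sum0 : (s ** d) ** (s ** d) + (q ** d) ** (q ** d) = 0.
  by rewrite !sqM// s2 q2 -!cmulDl xyd cmul0l.
have comm : commuting (s ** d) (q ** d).
  rewrite /commuting -cmulA (cmulA d) -dq -!cmulA !cmulA sq_q.
  by rewrite -!cmulA; congr (_ ** _); rewrite !cmulA ds.
have ssd : selfadjoint (s ** d) by exact: saM.
have sqd : selfadjoint (q ** d) by exact: saM.
have sd0 : s ** d = 0.
  apply/eqP; rewrite -normr_eq0 -sqrf_eq0; rewrite eq_le exprn_ge0// andbT.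
  by have := norm_sum_sq ssd sqd comm; rewrite sum0 normr0.
have qd0 : q ** d = 0.
  apply/eqP; rewrite -normr_eq0 -sqrf_eq0; rewrite eq_le exprn_ge0// andbT.
  by have := norm_sum_sq sqd ssd (commuting_sym comm); rewrite addrC sum0 normr0.
apply/eqP; rewrite -subr_eq0; apply/eqP/sa_sq_eq0 => //.
have xd : x ** d = 0 by rewrite -s2 -cmulA sd0 cmul0r.
have yd : y ** d = 0 by rewrite -q2 -cmulA qd0 cmul0r.
by rewrite -/d {1}/d cmulBl xd yd subrr.
Qed.

(** With a common [r] both roots come from one construction that respects intertwiners; uniqueness
    of positive roots identifies them with [x] and [y]. *)
Lemma pos_sq_intertwine x y w : pos x -> pos y ->
  w ** (x ** x) = (y ** y) ** w -> w ** x = y ** w.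
Proof.
move=> px py wxy; have [sx _] := px; have [sy _] := py.
have [sxx [r r0 rx]] := pos_sq sx; have [syy [q q0 qy]] := pos_sq sy.
have rq0 : 0 < r + q by exact: addr_gt0.
have {}rx : `|(r + q) *: e - x ** x| <= r + q.
  by apply: pos_le rx; rewrite lerDl ltW.
have {}qy : `|(r + q) *: e - y ** y| <= r + q.
  by apply: pos_le qy; rewrite lerDr ltW.
have := sqrt_scale_intertwine rq0 rx qy wxy.
have sqE u : pos u -> `|(r + q) *: e - u ** u| <= r + q ->
    sqrt_scale (r + q) (u ** u) = u.
  move=> pu ru; have [su _] := pu; apply: pos_sq_inj => //.
  - by apply: pos_sqrt_scale => //; exact: saM.
  - by apply/commuting_sym/sqrt_scale_intertwine => //; rewrite cmulA.
  - exact: sqrt_scale_sq.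
by rewrite !sqE.
Qed.

(* The positivity of [n] itself is never needed, only that of [n^3 = k^2]. *)
Lemma neg_part x : selfadjoint x -> exists n k, [/\ selfadjoint n,
  selfadjoint k, pos (x + 2 *: n), n ** x = - (n ** n)
  & k ** k = n ** n ** n].
Proof.
move=> sx.
have [m [pm mm mc]] := pos_sqrt (pos_sq sx); have [sm _] := pm.
have [s [[ss _] s2 sc]] := pos_sqrt pm.
have xm : commuting x m by apply: mc; exact: commutingM.
pose n := 2^-1 *: (m - x).
have sn : selfadjoint n by apply: saZ; [rewrite invr_ge0|exact: saB].
have sn_comm : commuting s n.
  apply/commutingZ/commutingB; first by apply/commuting_sym/sc.
  by apply/commuting_sym/sc.
have x2 : x + 2 *: n = m by rewrite /n scalerA divff ?pnatr_eq0// scale1r addrC subrK.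
have nx : n ** x = - (n ** n).
  apply/eqP; rewrite -subr_eq0 opprK -cmulDr.
  have -> : x + n = 2^-1 *: (m + x).
    rewrite -[x in LHS]half_add /n -scalerDr -addrA.
    by rewrite [x + (m - x)]addrC subrK addrC.
  by rewrite /n cmulZl cmulZr cmulBl !cmulDr mm xm opprD addrA addrK subrr !scaler0.
have xn : x ** n = - (n ** n) by rewrite -{1}sx -{1}sn -cstarM nx cstarN cstarM sn.
have mn : m ** n = n ** n.
  by rewrite -x2 cmulDl cmulZl xn scaler_nat mulr2n addKr.
(* Here [m = s^2] is the absolute value of [x], and [m n = n^2] gives [(s n)^2 = m n^2 = n^3]. *)
exists n, (s ** n); split => //; first exact: saM.
  by rewrite x2.
rewrite -cmulA -mn -s2 -!cmulA; congr (_ ** _).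
by rewrite !cmulA sn_comm.
Qed.

(** For the negative part [n] of [y^* y] and [w = y n] one has [w^* w = - n^3 = - k^2]. Since
    [w w^* + w^* w] is half a sum of two squares, [p = w w^*] is positive. The textbook proof now
    compares the spectra of [w w^*] and [w^* w]; uniqueness of positive roots takes their place. *)
Lemma pos_starM y : pos (cstar y ** y).
Proof.
set x := cstar y ** y; have sx : selfadjoint x by exact: sa_starM.
have [n [k [sn sk pm nx kk]]] := neg_part sx.
pose w := y ** n.
have ww : cstar w ** w = - (k ** k).
  by rewrite cstarM sn -cmulA (cmulA (cstar y)) -/x cmulA nx cmulNl kk.
pose a := w + cstar w; pose b := 'i *: (w - cstar w).
have sa : selfadjoint a by rewrite /selfadjoint cstarD cstarK addrC.
have sb : selfadjoint b.
  by rewrite /selfadjoint cstarZ cstarB cstarK conjc_i scaleNr -scalerN opprB.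
have aabb : a ** a + b ** b =
    (w ** cstar w + cstar w ** w) + (w ** cstar w + cstar w ** w).
  rewrite cmulZl cmulZr scalerA -expr2 sqr_i scaleN1r cmulBl !cmulBr !opprB.
  rewrite /a cmulDl !cmulDr.
  set C := cstar w ** w; set D := cstar w ** cstar w.
  rewrite [C - D + _]addrC addrACA [_ + (w ** cstar w - _)]addrC subrKA.
  by rewrite [C + D + _]addrACA subrr addr0 addrACA.
pose p := w ** cstar w.
have pp : pos p.
  have -> : p = 2^-1 *: (a ** a + b ** b) + k ** k.
    by rewrite aabb half_add ww addrNK.
  by apply: posD; [apply: posZ; [rewrite invr_ge0|apply: posD; exact: pos_sq]
                  |exact: pos_sq].
(* Iterating [w k^2 = - p w] gives [w (k^2)^2 = p^2 w]. As [k^2] and [p] are positive, taking roots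
   gives [w k^2 = p w]; the two signs force [p w = 0]. *)
have wk : w ** (k ** k) = - (p ** w) by rewrite /p -cmulA ww cmulNr opprK.
have pw : p ** w = 0.
  have : w ** (k ** k) = p ** w.
    apply: pos_sq_intertwine => //; first exact: pos_sq.
    by rewrite cmulA wk cmulNl -cmulA wk cmulNr opprK cmulA.
  by rewrite wk => h; rewrite -(half_add (p ** w)) -{1}h addNr scaler0.
have w0 : w = 0.
  apply: starM_eq0; apply: sa_sq_eq0; first exact: sa_starM.
  by rewrite -cmulA [w ** (_ ** _)]cmulA pw cmul0r.
have n0 : n = 0.
  have nnn : n ** n ** n = 0.
    by apply/eqP; rewrite -kk -oppr_eq0 -ww w0 cmul0r.
  apply: sa_sq_eq0 => //; apply: sa_sq_eq0; first exact: saM.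
  by rewrite cmulA nnn cmul0l.
by move: pm; rewrite n0 scaler0 addr0.
Qed.

(** * Neumann series and invertibility *)

Fixpoint neumann_iter t n : A :=
  if n is m.+1 then e + t ** neumann_iter t m else 0.

Lemma invertible_contraction t : `|t| < 1 -> invertible e (e - t).
Proof.
move=> t1; pose q := complex.Re `|t|.
have tq : `|t| = q%:C by rewrite RRe_real// ger0_real.
have q0 : 0 <= q by rewrite -ler0c -tq.
have q1 : q < 1 by rewrite -ltcR -tq.
pose u := neumann_iter t.
have uc n : commuting t (u n).
  elim: n => [|n ih] /=; first by rewrite /commuting cmul0l cmul0r.
  by apply: commutingD; [exact: commuting1|exact: commutingM].
have : cvg (u @ \oo).
  have q1' : 1 - q != 0 by rewrite subr_eq0 gt_eqF.
  apply: (@cvg_majorant _ _ _ (fun n => (1 - q ^+ n) / (1 - q)) (1 - q)^-1) => n.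
    have -> : (1 - q ^+ n.+1) / (1 - q) - (1 - q ^+ n) / (1 - q) = q ^+ n.
      rewrite -mulrBl opprB addrC subrKA exprS -{1}[q ^+ n]mul1r -mulrBl.
      by rewrite mulrAC divff// mul1r.
    rewrite rmorphXn/= -tq.
    elim: n => [|n ih]; first by rewrite /u /= cmul0r subr0 addr0 norm_unit expr0.
    have -> : u n.+2 - u n.+1 = t ** (u n.+1 - u n).
      by rewrite cmulBr /u /= opprD addrACA subrr add0r.
    rewrite exprS.
    by rewrite (le_trans (ler_normcM _ _))// ler_wpM2l.
  by rewrite ler_piMl ?invr_ge0 ?subr_ge0 ?(ltW q1)// gerBl exprn_ge0.
move=> /cvg_ex[g ug]; exists g.
have ug1 : (fun n => u n.+1) @ \oo --> g by rewrite cvg_shiftS.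
have ug2 : (fun n => u n.+1) @ \oo --> e + t ** g.
  by apply: cvgD; [exact: cvg_cst|apply: cvg_cmul => //; exact: cvg_cst].
have ug3 : (fun n => u n.+1) @ \oo --> e + g ** t.
  rewrite (_ : (fun n => _) = (fun n => e + u n ** t)).
    by apply: cvgD; [exact: cvg_cst|apply: cvg_cmul => //; exact: cvg_cst].
  by apply/funext => n; rewrite -uc.
have gE := norm_cvg_unique ug1 ug2; have gE' := norm_cvg_unique ug1 ug3.
split; first by rewrite cmulBl cmul1l {1}gE addrK.
by rewrite cmulBr cmul1r {1}gE' addrK.
Qed.

(** With [r = |k| + d], [pos_norm_le] gives [|r - k| <= r - d < r], so the Neumann series inverts
    [k / r = e - (r - k) / r]. *)
Lemma invertible_pos k (d : R[i]) : 0 < d -> pos (k - d *: e) -> invertible e k.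
Proof.
move=> d0 pkd.
have pk : pos k.
  by rewrite -(subrK (d *: e) k); apply: posD => //; apply: posZ (ltW d0) pos1.
have [sk _] := pk; pose r := `|k| + d.
have r0 : 0 < r by rewrite ltr_wpDl.
have rkd : `|r *: e - k| <= r - d.
  have rd : r - d = `|k| by rewrite addrK.
  apply: pos_norm_le; first by rewrite rd.
    rewrite scalerDl addrAC; apply: posD; first exact: pos_norm_sub.
    exact: posZ (ltW d0) pos1.
  by rewrite scalerBl opprB addrC subrKA.
have [|g [kg gk]] := @invertible_contraction (r^-1 *: (r *: e - k)).
  rewrite normrZ normfV gtr0_norm// ltr_pdivrMl// mulr1 (le_lt_trans rkd)//.
  by rewrite ltrBlDr ltrDl.
move: kg gk; rewrite scalerBr scalerA mulVf ?gt_eqF// scale1r subKr => kg gk.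
by exists (r^-1 *: g); split; [rewrite cmulZr -cmulZl|rewrite cmulZl -cmulZr].
Qed.

Lemma invertible_of_starM a : invertible e (cstar a ** a) ->
  invertible e (a ** cstar a) -> invertible e a.
Proof.
move=> [b [_ ba]] [c [ac _]]; exists (cstar a ** c).
have : b ** cstar a = cstar a ** c.
  by rewrite -[LHS]cmul1r -ac -[RHS]cmul1l -ba !cmulA.
by move=> bc; split; [rewrite cmulA|rewrite -bc -cmulA].
Qed.

End positivity.

(** * Pure states *)

Section infima.
Variable R : realType.

Lemma le_mul_inf (E : set R) (m r : R) : E !=set0 -> 0 <= r ->
  (forall t, E t -> m <= r * t) -> m <= r * inf E.
Proof.
move=> E0; rewrite le_eqVlt => /predU1P[<- h|r0 h].
  by case: E0 => t /h; rewrite !mul0r.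
rewrite -ler_pdivrMl//; apply: lb_le_inf => // t /h.
by rewrite ler_pdivrMl.
Qed.

Lemma le_add_inf (E F : set R) (m : R) : E !=set0 -> F !=set0 ->
  (forall t u, E t -> F u -> m <= t + u) -> m <= inf E + inf F.
Proof.
move=> E0 F0 h; rewrite -lerBlDr; apply: lb_le_inf => // t Et.
rewrite lerBlDr addrC -lerBlDr; apply: lb_le_inf => // u Fu.
by rewrite lerBlDr addrC; exact: h.
Qed.

End infima.

Section states.
Variables (R : realType) (A : cstarAlgType R) (e : A).
Hypothesis eU : is_unit e.
Implicit Types (x y : A) (f g p q : A -> R).

(* Functionals live on all of [A], regarded as a real vector space, with the
   order given by hermitian parts. *)
Definition hpos x := pos e (x + cstar x).

Lemma herm_scale (r : R) x :
  r%:C *: x + cstar (r%:C *: x) = r%:C *: (x + cstar x).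
Proof. by rewrite cstarZ conjc_real scalerDr. Qed.

Lemma hposD x y : hpos x -> hpos y -> hpos (x + y).
Proof. by rewrite /hpos cstarD addrACA; exact: posD. Qed.

Lemma hposZ (r : R) x : 0 <= r -> hpos x -> hpos (r%:C *: x).
Proof. by rewrite /hpos herm_scale => r0; apply: (posZ eU); rewrite // ler0c. Qed.

Lemma hpos_pos x : pos e x -> hpos x.
Proof. by move=> px; rewrite /hpos px.1; exact: posD. Qed.

Lemma hpos0 : hpos 0.
Proof. by apply: hpos_pos; exact: pos0. Qed.

Lemma hpos_norm x : hpos (`|x| *: e - x).
Proof.
rewrite /hpos cstarB cstarZ (sa_unit eU) conjc_ge0// addrACA -opprD.
rewrite -scalerDl; set h := x + cstar x.
have sh : selfadjoint h by rewrite /selfadjoint cstarD cstarK addrC.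
have : pos e ((`|x| + `|x| - `|h|) *: e + (`|h| *: e - h)).
  apply: posD => //; last exact: pos_norm_sub.
  apply: (posZ eU); last exact: pos1.
  by rewrite subr_ge0 (le_trans (ler_normD _ _))// norm_cstar.
by rewrite scalerBl addrA subrK.
Qed.

Definition rlinear f := (forall x y, f (x + y) = f x + f y) /\
  forall (r : R) x, f (r%:C *: x) = r * f x.

Definition positive_functional f := rlinear f /\ forall x, hpos x -> 0 <= f x.

(** Extremality in the cone of positive functionals; when [f e = 1], evaluation at [e] shows that
    the factor can only be [g e]. *)
Definition pure f := forall g h, positive_functional g ->
  positive_functional h -> (forall x, g x + h x = f x) ->
  forall x, g x = g e * f x.

Lemma rlinearN f x : rlinear f -> f (- x) = - f x.
Proof. by case=> _ /(_ (-1) x); rewrite rmorphN rmorph1 scaleN1r mulN1r. Qed.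

Definition sublinear p := (forall x y, p (x + y) <= p x + p y) /\
  forall (r : R) x, 0 <= r -> p (r%:C *: x) <= r * p x.

Lemma sublinear0 p : sublinear p -> p 0 = 0.
Proof.
move=> [pD pZ]; apply/eqP; rewrite eq_le; apply/andP; split.
  by have := pZ 0 0 (lexx 0); rewrite scaler0 mul0r.
by have := pD 0 0; rewrite addr0 -[leLHS]addr0 lerD2l.
Qed.

Lemma sublinearN p x : sublinear p -> - p (- x) <= p x.
Proof.
move=> sp; rewrite -subr_ge0 opprK -(sublinear0 sp) -(subrr x).
by case: sp => + _; exact.
Qed.

(* On suprema [p] of sets of states: the set is a face. *)
Definition face p := forall f g, positive_functional f ->
  positive_functional g -> (forall x, f x + g x <= p x) ->
  forall x, f x <= f e * p x.

Section tangent.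
Variables (p : A -> R) (x : A).
Hypothesis sp : sublinear p.

Let dset y := [set t : R | exists2 s : R, 0 <= s & t = p (s%:C *: x + y) - s * p x].

(* The one-sided directional derivative of [p] at [x] (with [s] the inverse of
   the step), that is, the support function of the face where [x] is maximal. *)
Definition tangent y := inf (dset y).

Let dset0 y : dset y !=set0.
Proof. by exists (p y), 0 => //; rewrite scale0r add0r mul0r subr0. Qed.

Let dset_lb y : has_lbound (dset y).
Proof.
exists (- p (- y)) => _ [s s0 ->]; rewrite lerBrDr addrC lerBlDr.
have := sp.1 (s%:C *: x + y) (- y); rewrite addrK; apply: le_trans.
rewrite le_eqVlt in s0; move/predU1P : s0 => [<-|s0].
  by rewrite mul0r scale0r sublinear0.
have := sp.2 s^-1 (s%:C *: x); rewrite invr_ge0 (ltW s0) => /(_ isT).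
by rewrite scalerA -rmorphM mulVf ?gt_eqF// scale1r ler_pdivlMl.
Qed.

Lemma tangent_le_diff (s : R) y : 0 <= s -> tangent y <= p (s%:C *: x + y) - s * p x.
Proof. by move=> s0; apply: ge_inf => //; exists s. Qed.

Lemma tangent_le y : tangent y <= p y.
Proof.
by have := tangent_le_diff y (lexx 0); rewrite scale0r add0r mul0r subr0.
Qed.

(** This is the step [s = 1]. For a minimal [p], which lies below its tangent, it reads
    [p (- x) <= - p x], the converse of [sublinearN]: the source of linearity. *)
Lemma tangentN : tangent (- x) <= - p x.
Proof.
have := tangent_le_diff (- x) ler01.
by rewrite scale1r subrr sublinear0// mul1r sub0r.
Qed.

Lemma tangent_sublinear : sublinear tangent.
Proof.
split=> [y z|r y r0].
  apply: le_add_inf => // _ _ [s s0 ->] [t t0 ->].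
  rewrite (le_trans (tangent_le_diff _ (addr_ge0 s0 t0)))//.
  rewrite rmorphD/= scalerDl [X in p X]addrACA mulrDl opprD [leRHS]addrACA lerD2r.
  exact: sp.1.
apply: le_mul_inf => // _ [s s0 ->].
rewrite (le_trans (tangent_le_diff _ (mulr_ge0 r0 s0)))//.
by rewrite rmorphM/= -scalerA -scalerDr -mulrA mulrBr lerD2r sp.2.
Qed.

(** If [f + g] lies below the tangent, then [f x + g x = p x]. As [f x <= f e * p x],
    [g x <= g e * p x] and [f e + g e = 1], both are equalities. Subtracting [s f x] from the face
    inequality at [s x + y] bounds [f y] by [f e] times each difference. *)
Lemma tangent_face : p e <= 1 -> p (- e) <= -1 -> face p -> face tangent.
Proof.
move=> pe pe' fp f g ff fg fgp.
have [[lf pf] [lg pg]] := (ff, fg).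
have fgp' y : f y + g y <= p y by exact: le_trans (fgp y) (tangent_le y).
have fgC' y : g y + f y <= p y by rewrite addrC.
have fle := fp f g ff fg fgp' x; have gle := fp g f fg ff fgC' x.
have fge : f e + g e = 1.
  apply/eqP; rewrite eq_le (le_trans (fgp' e) pe)/= -lerN2 opprD.
  rewrite -(rlinearN e lf) -(rlinearN e lg). 
  by apply: (le_trans (fgp' (- e))).
have pfg : p x <= f x + g x.
  rewrite -lerN2 opprD -(rlinearN x lf) -(rlinearN x lg).
  exact: le_trans (fgp _) tangentN.
have fx : f x = f e * p x.
  apply/eqP; rewrite eq_le fle/= -(lerD2r (g e * p x)) -mulrDl fge mul1r.
  by rewrite (le_trans pfg)// lerD2l.
move=> y; apply: le_mul_inf => //; first by apply: pf; exact/hpos_pos/pos1.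
move=> _ [s s0 ->]; rewrite mulrBr mulrCA -fx lerBrDr.
have := fp f g ff fg fgp' (s%:C *: x + y).
by rewrite lf.1 lf.2 addrC.
Qed.

End tangent.

(** * A pure state vanishing at [k] *)

Section pure_state.
Variable k : A.
Hypothesis pk : hpos k.
Hypothesis pkN : forall d : R, 0 < d -> ~ hpos (k - d%:C *: e).

Let nset x := [set t : R | exists2 s : R, 0 <= s & hpos (t%:C *: e - x + s%:C *: k)].

(* The support function of the set of states that vanish at [k]. *)
Definition null_gauge x := inf (nset x).

Let normE x : (complex.Re `|x|)%:C = `|x|.
Proof. by rewrite RRe_real// ger0_real. Qed.

Let nset0 x : nset x !=set0.
Proof.
exists (complex.Re `|x|), 0; rewrite // scale0r addr0 normE; exact: hpos_norm.
Qed.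

Let nset_lb x : has_lbound (nset x).
Proof.
exists (- complex.Re `|x|) => t [s s0 h]; rewrite leNgt; apply/negP => tx.
(* Adding [|x| + x] and one more [k] to [t - x + s k] leaves [(s + 1) (k - d)]; the extra [k] keeps
   the divisor positive when [s = 0]. *)
pose d := (- complex.Re `|x| - t) / (s + 1).
have s1 : 0 < s + 1 by rewrite ltr_wpDl.
have d0 : 0 < d by rewrite divr_gt0// subr_gt0.
apply: (pkN d0).
have := hposD h (hpos_norm (- x)); rewrite normrN opprK.
move=> /(hposD pk); have s1' : 0 <= (s + 1)^-1 by rewrite invr_ge0 ltW.
move=> /(hposZ s1'); congr hpos.
have -> : k - d%:C *: e = (s + 1)^-1%:C *: ((s + 1)%:C *: (k - d%:C *: e)).
  by rewrite scalerA -rmorphM mulVf ?gt_eqF// scale1r.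
congr (_ *: _); rewrite scalerBr scalerA -rmorphM.
have -> : (s + 1) * d = - complex.Re `|x| - t by rewrite mulrC divfK// gt_eqF.
have -> : t%:C *: e - x + s%:C *: k + (`|x| *: e + x) =
    s%:C *: k + (t%:C *: e + `|x| *: e).
  rewrite [t%:C *: e - x + _]addrAC [_ *: e + x]addrC addrA addrNK.
  by rewrite [X in X + _]addrC -addrA.
rewrite -scaleNr -rmorphN/= opprD !opprK !rmorphD/= !scalerDl scale1r normE.
by rewrite addrA [k + _]addrC [t%:C *: e + _]addrC.
Qed.

Lemma null_gauge_le (t s : R) x : 0 <= s -> hpos (t%:C *: e - x + s%:C *: k) ->
  null_gauge x <= t.
Proof. by move=> s0 h; apply: (ge_inf (nset_lb x)); exists s. Qed.

Lemma null_gauge_sublinear : sublinear null_gauge.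
Proof.
split=> [x y|r x r0].
  apply: le_add_inf => // t u [s s0 h] [v v0 k'].
  apply: (null_gauge_le (addr_ge0 s0 v0)).
  have := hposD h k'; congr hpos.
  rewrite (rmorphD _ t) (rmorphD _ s) !scalerDl opprD [LHS]addrACA.
  by congr (_ + _); rewrite addrACA.
apply: le_mul_inf => // t [s s0 h].
apply: (null_gauge_le (mulr_ge0 r0 s0)).
have := hposZ r0 h; congr hpos.
by rewrite !scalerDr scalerN !scalerA -!rmorphM.
Qed.

Lemma null_gauge_unit : null_gauge e <= 1.
Proof.
apply: (null_gauge_le (lexx 0)).
by rewrite scale1r subrr scale0r addr0; exact: hpos0.
Qed.

Lemma null_gauge_hpos x : hpos x -> null_gauge (- x) <= 0.
Proof.
by move=> px; apply: (null_gauge_le (lexx 0)); rewrite !scale0r addr0 add0r opprK.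
Qed.

Lemma null_gaugeNunit : null_gauge (- e) <= -1.
Proof.
apply: (null_gauge_le (lexx 0)).
by rewrite scale0r addr0 opprK rmorphN rmorph1 scaleN1r addNr; exact: hpos0.
Qed.

Lemma null_gauge_null : null_gauge k <= 0.
Proof.
apply: (null_gauge_le ler01).
by rewrite scale0r add0r scale1r addNr; exact: hpos0.
Qed.

(** [f k] and [g k] are nonnegative with sum at most [null_gauge k <= 0], so [f k = 0]; applying [f]
    to [t - x + s k] then gives [f x <= t f e]. *)
Lemma null_gauge_face : face null_gauge.
Proof.
move=> f g [lf pf] [lg pg] fgp x.
have fk : f k = 0.
  apply/eqP; rewrite eq_le pf// andbT -[leLHS]addr0.
  by rewrite (le_trans (lerD (lexx _) (pg _ pk)))// (le_trans (fgp k) null_gauge_null).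
apply: le_mul_inf => //; first by apply: pf; exact/hpos_pos/pos1.
move=> t [s s0 /pf]; rewrite !lf.1 rlinearN// !lf.2 fk mulr0 addr0.
by rewrite subr_ge0 mulrC.
Qed.

Definition null_face p :=
  [/\ sublinear p, face p & forall x, p x <= null_gauge x].

(** Pointwise infima are finite because members are at least [- null_gauge (- x)] at [x]. For
    subadditivity, totality provides one member below both chosen ones. *)
Lemma null_face_chain (C : set {p | null_face p}) :
  total_on C (fun u v => `[< forall x, sval v x <= sval u x >]) ->
  exists v : {p | null_face p}, forall u, C u -> forall x, sval v x <= sval u x.
Proof.
move=> totC; have [[u0 Cu0]|C0] := pselect (C !=set0); last first.
  exists (exist _ null_gauge (And3 null_gauge_sublinear null_gauge_face
    (fun x => lexx (null_gauge x)))) => u Cu.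
  by case: C0; exists u.
pose vals x := [set sval u x | u in C]; pose q x := inf (vals x).
have vals0 x : vals x !=set0 by exists (sval u0 x), u0.
have qle u x : C u -> q x <= sval u x.
  move=> Cu; apply: ge_inf; last by exists u.
  exists (- null_gauge (- x)) => _ [v Cv <-].
  have [sv _ vn] := svalP v.
  by rewrite (le_trans _ (sublinearN x sv))// lerN2.
suff nq : null_face q by exists (exist _ q nq) => u Cu x; exact: qle.
split.
- split=> [x y|r x r0].
    apply: le_add_inf => // _ _ [u Cu <-] [v Cv <-].
    have sub (w : {p | null_face p}) : C w -> sval w x <= sval u x ->
        sval w y <= sval v y -> q (x + y) <= sval u x + sval v y.
      move=> Cw wx wy; have [[wD _] _ _] := svalP w.
      by rewrite (le_trans (qle _ _ Cw))// (le_trans (wD _ _))// lerD.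
    have [/asboolP h|/asboolP h] := totC _ _ Cu Cv.
      exact: (sub v).
    exact: (sub u).
  apply: le_mul_inf => // _ [u Cu <-].
  have [[_ pZ] _ _] := svalP u.
  by rewrite (le_trans (qle _ _ Cu))// pZ.
- move=> f g ff fg fgq x; apply: le_mul_inf => //.
    by case: ff => _; apply; exact/hpos_pos/pos1.
  move=> _ [u Cu <-]; have [_ fu _] := svalP u.
  by apply: (fu f g ff fg) => y; exact: le_trans (fgq y) (qle _ _ Cu).
- move=> x; rewrite (le_trans (qle _ x Cu0))//.
  by have [_ _] := svalP u0; exact.
Qed.

(** A minimal [p] coincides with its tangents, so it is odd, hence linear. For linear [p] the face
    inequality at [x] and at [- x] is purity. *)
Lemma pure_state_exists : exists f,
  [/\ positive_functional f, f e = 1, f k = 0 & pure f].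
Proof.
(* The order is reversed, so a maximal element for [ord] is pointwise minimal. *)
pose ord (u v : {p | null_face p}) := `[< forall x, sval v x <= sval u x >].
have np0 : null_face null_gauge.
  by split=> //; [exact: null_gauge_sublinear|exact: null_gauge_face].
have [|||[p [sp fp pn]] pmin] := @ZL_preorder _ (exist _ _ np0) ord.
- by move=> u; apply/asboolP.
- move=> v u w /asboolP uv /asboolP vw; apply/asboolP => x.
  exact: le_trans (vw x) (uv x).
- move=> C /null_face_chain[v vC]; exists v => u Cu.
  by apply/asboolP; exact: vC.
have pe : p e <= 1 by exact: le_trans (pn e) null_gauge_unit.
have pe' : p (- e) <= -1 by exact: le_trans (pn _) null_gaugeNunit.
have pN x : p (- x) = - p x.
  apply/eqP; rewrite eq_le lerNl sublinearN// andbT.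
  have nt : null_face (tangent p x).
    split; [exact: tangent_sublinear|exact: tangent_face|].
    by move=> y; rewrite (le_trans (tangent_le _ sp _)).
  have /asboolP/(_ (- x)) : ord (exist _ _ nt) (exist _ p (And3 sp fp pn)).
    by apply: pmin; apply/asboolP => y; exact: tangent_le.
  by move=> /= h; exact: le_trans h (tangentN _ sp).
have pD x y : p (x + y) = p x + p y.
  apply/eqP; rewrite eq_le sp.1/= -lerN2 opprD -!pN opprD.
  exact: sp.1.
have pZ0 (r : R) x : 0 <= r -> p (r%:C *: x) = r * p x.
  move=> r0; apply/eqP; rewrite eq_le sp.2//= -lerN2 -mulrN -!pN -scalerN.
  exact: sp.2.
have pZ (r : R) x : p (r%:C *: x) = r * p x.
  have [|/ltW r0] := leP 0 r; first exact: pZ0.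
  have := @pZ0 (- r) x; rewrite oppr_ge0 => /(_ r0).
  by rewrite rmorphN/= scaleNr pN mulNr => /oppr_inj.
have p0 : positive_functional p.
  split=> // x px; rewrite -oppr_le0 -pN.
  exact: le_trans (pn _) (null_gauge_hpos px).
have p1 : p e = 1.
  by apply/eqP; rewrite eq_le pe/= -lerN2 -pN.
exists p; split=> //.
  apply/eqP; rewrite eq_le p0.2// andbT.
  exact: le_trans (pn k) null_gauge_null.
move=> g h pg ph gh x.
have gp y : g y + h y <= p y by rewrite gh.
apply/eqP; rewrite eq_le (fp _ _ pg ph gp)/=.
have := fp _ _ pg ph gp (- x); rewrite pN rlinearN; last exact: pg.1.
by rewrite mulrN lerN2.
Qed.

End pure_state.
End states.

(** * Semi-inner products *)

Section approximation.
Variable R : realType.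
Local Notation C := R[i].
Implicit Types (x y z eps d : C).

Lemma eq_approx x y (M : C) : (forall d, 0 < d <= 1 -> `|x - y| <= M * d) -> x = y.
Proof.
move=> h; apply/eqP; rewrite -subr_eq0 -normr_le0; apply/ler_addgt0Pl => eps e0.
have h1 : `|x - y| <= M by have := h 1; rewrite ltr01 lexx mulr1; exact.
rewrite addr0; have M0 : 0 <= M by exact: le_trans h1.
have M1 : 0 < M + 1 by rewrite ltr_wpDl.
have d0 : 0 < eps / (M + 1) by rewrite divr_gt0.
have [d1|d1] := boolP (eps / (M + 1) <= 1).
  have hd : `|x - y| <= M * (eps / (M + 1)) by apply: h; rewrite d0.
  rewrite (le_trans hd)// mulrCA ler_piMr// ?(ltW e0)//.
  by rewrite ler_pdivrMr// mul1r lerDl.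
have {}d1 : 1 <= eps / (M + 1).
  by rewrite real_leNgt ?real1 ?gtr0_real//; apply: contra d1 => /ltW.
rewrite ler_pdivlMr// mul1r in d1; rewrite (le_trans h1)//.
by rewrite (le_trans _ d1)// lerDl.
Qed.

Lemma ge0_approx x (M : C) :
  (forall d, 0 < d <= 1 -> exists2 z, 0 <= z & `|x - z| <= M * d) -> 0 <= x.
Proof.
move=> h; suff -> : x = `|x| by [].
apply: (@eq_approx _ _ (M + M)) => d /h[z z0 xz].
have {1}-> : x = (x - z) + z by rewrite subrK.
rewrite -addrA mulrDl (le_trans (ler_normD _ _))// lerD//.
rewrite -{1}(ger0_norm z0) (le_trans (ler_dist_dist _ _))//.
by rewrite distrC.
Qed.

Definition harm n : C := n.+1%:R^-1.

Lemma harm_itv n : 0 < harm n <= 1.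
Proof. by rewrite invr_gt0 ltr0n/= invf_le1 ?ltr0n// ler1n. Qed.

Lemma harm_small eps : 0 < eps -> exists n, forall m, (n <= m)%N -> harm m <= eps.
Proof.
move=> /cplx_real_gt0[r r0 ->].
have /cvgrPdist_le/(_ _ r0)[N _ hN] := @cvg_harmonic R.
exists N => m /hN; rewrite /= sub0r normrN ger0_norm ?harmonic_ge0//.
by rewrite -lecR /harm fmorphV rmorph_nat.
Qed.

Lemma harm_cauchy (u : nat -> C) (M : C) : 0 <= M ->
  (forall n m, `|u n - u m| <= M * (harm n + harm m)) ->
  exists l, forall n, `|l - u n| <= M * harm n.
Proof.
move=> M0 h; have M1 : 0 < M + 1 by rewrite ltr_wpDl.
have small eps : 0 < eps -> exists n, forall m, (n <= m)%N -> M * harm m <= eps.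
  move=> e0; have [|n hn] := @harm_small (eps / (M + 1)).
    by rewrite divr_gt0.
  exists n => m /hn; rewrite ler_pdivlMr// mulrC; apply: le_trans.
  by rewrite ler_wpM2r ?lerDl// ltW//; case/andP: (harm_itv m).
have /cvg_ex[l ul] : cvg ((u : nat -> R[i]^o) @ \oo).
  apply: complex_complete; apply/cauchy_exP => eps e0.
  have e3 : 0 < eps / 2 / 2 by rewrite !divr_gt0.
  have [n hn] := small _ e3; exists (u n), n => // m /= nm.
  rewrite -ball_normE/= (le_lt_trans (h _ _))// mulrDr.
  rewrite (le_lt_trans (lerD (hn _ (leqnn n)) (hn _ nm)))// -splitr.
  by rewrite [ltRHS]splitr ltrDl divr_gt0.
exists l => n; apply/ler_addgt0Pr => eps e0.
have e2 : 0 < eps / 2 by rewrite divr_gt0.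
have [N hN] := small _ e2.
move/cvgrPdist_le : ul => /(_ _ e2)[N' _ ul].
pose m := maxn N N'.
rewrite -(subrK (u m) l) -addrA (le_trans (ler_normD _ _))//.
have := ul m (leq_maxr _ _) => /= um.
have := hN m (leq_maxl _ _) => um'.
rewrite (le_trans (lerD um (h m n)))// mulrDr addrA addrC lerD2l.
by rewrite [leRHS]splitr lerD2l.
Qed.

End approximation.

Section semi_inner.
Variables (R : realType) (V : lmodType R[i]).

Record semi_inner := SemiInner {
  sip :> V -> V -> R[i];
  sipDl : forall x y z, sip (x + y) z = sip x z + sip y z;
  sipZl : forall l x y, sip (l *: x) y = l * sip x y;
  sipC : forall x y, sip y x = (sip x y)^*%C;
  sip_ge0 : forall x, 0 <= sip x x }.

Variable s : semi_inner.
Implicit Types (x y z : V) (l : R[i]).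

Lemma sipDr x y z : s x (y + z) = s x y + s x z.
Proof. by rewrite sipC sipDl rmorphD/= -!sipC. Qed.

Lemma sipZr l x y : s x (l *: y) = l^*%C * s x y.
Proof. by rewrite sipC sipZl rmorphM/= -sipC. Qed.

Lemma sipNl x y : s (- x) y = - s x y.
Proof. by rewrite -scaleN1r sipZl mulN1r. Qed.

Lemma sipNr x y : s x (- y) = - s x y.
Proof. by rewrite sipC sipNl rmorphN/= -sipC. Qed.

Definition snorm x := sqrtC (s x x).

Lemma snorm_ge0 x : 0 <= snorm x.
Proof. by rewrite sqrtC_ge0 sip_ge0. Qed.

Lemma snorm_sq x : snorm x ^+ 2 = s x x.
Proof. exact: sqrtCK. Qed.

Lemma snormZ l x : snorm (l *: x) = `|l| * snorm x.
Proof.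
apply/eqP; rewrite -(@eqrXn2 _ 2) ?snorm_ge0 ?mulr_ge0 ?snorm_ge0//.
by rewrite exprMn !snorm_sq sipZl sipZr mulrA -[_ * _^*%C]/(l * l^*) -normCK.
Qed.

Lemma sip_le x y : `|s x y| <= snorm x * snorm y.
Proof.
set c := s x y; set b := s y y; set a := s x x.
have key l : 0 <= a - l^*%C * c - l * c^*%C + l * l^*%C * b.
  have := sip_ge0 s (x - l *: y).
  rewrite sipDl !sipDr !sipNl !sipNr !sipZl !sipZr -(sipC s x y) opprK.
  by rewrite mulrA !addrA.
have ccE : c * c^*%C = `|c| ^+ 2 by rewrite normCK.
have keyr (t : R[i]) : 0 <= t -> 2 * t * `|c| ^+ 2 <= a + t ^+ 2 * `|c| ^+ 2 * b.
  move=> t0; have := key (t * c).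
  rewrite rmorphM/= (conjc_ge0 t0) -[in X in _ -> X]subr_ge0.
  by congr (0 <= _); rewrite -ccE; ring.
have [b0|b0] := eqVneq b 0.
  have [->|c0] := eqVneq c 0; first by rewrite normr0 mulr_ge0 ?snorm_ge0.
  have c2 : 0 < `|c| ^+ 2 by rewrite exprn_gt0// normr_gt0.
  have a1 : 0 < a + 1 by rewrite ltr_wpDl// sip_ge0.
  (* When [b = 0], this [t] turns [keyr] into [2 (a + 1) <= a], which is absurd. *)
  have := keyr ((a + 1) / `|c| ^+ 2); rewrite divr_ge0 ?(ltW a1) ?(ltW c2)//.
  move=> /(_ isT); rewrite b0 mulr0 addr0 -mulrA divfK ?gt_eqF//.
  by rewrite mulr_natl mulr2n -[leRHS]addr0 -addrA lerD2l (lt_geF (addr_gt0 _ a1)).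
have {}b0 : 0 < b by rewrite lt_def b0 sip_ge0.
rewrite -ler_sqr ?nnegrE ?mulr_ge0 ?snorm_ge0//.
have := keyr b^-1; rewrite invr_ge0 ltW// => /(_ isT).
have -> : b^-1 ^+ 2 * `|c| ^+ 2 * b = b^-1 * `|c| ^+ 2 by field; rewrite gt_eqF.
rewrite -mulrA mulr_natl mulr2n lerD2r ler_pdivrMl// exprMn !snorm_sq.
by rewrite [X in _ -> _ <= X]mulrC.
Qed.

Lemma snormD x y : snorm (x + y) <= snorm x + snorm y.
Proof.
rewrite -ler_sqr ?nnegrE ?addr_ge0 ?snorm_ge0// sqrrD !snorm_sq.
rewrite sipDl !sipDr addrA lerD2r -addrA lerD2l.
rewrite (sipC s x y); set c := s x y.
have cr : c + c^*%C \is Num.real.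
  apply/CrealP; rewrite rmorphD addrC; congr (_ + _).
  exact: conjcK.
rewrite (le_trans (real_ler_norm cr))// (le_trans (ler_normD _ _))//.
rewrite [`|c^*%C|]norm_conjC mulr2n.
by rewrite lerD// sip_le.
Qed.

End semi_inner.

(** * Completion of a semi-inner product space *)

Section completion.
Variables (R : realType) (V : lmodType R[i]) (s : semi_inner V).
Implicit Types (a b : V) (F G : V -> R[i]^o) (d : R[i]).

Definition approximates d F a := forall b, `|F b - s a b| <= d * snorm s b.

(* The completion is realised inside the space of antilinear functionals, [a]
   being identified with [s a]. *)
Definition approximable : {pred V -> R[i]^o} :=
  fun F => `[< forall d, 0 < d -> exists a, approximates d F a >].

Lemma approximatesD d d' F G a b : approximates d F a -> approximates d' G b ->
  approximates (d + d') (F + G) (a + b).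
Proof.
move=> Fa Gb c; rewrite sipDl opprD mulrDl -[(F + G) c]/(F c + G c) addrACA.
by rewrite (le_trans (ler_normD _ _))// lerD.
Qed.

Lemma approximatesZ d F a (l : R[i]) : approximates d F a ->
  approximates (`|l| * d) (l *: F) (l *: a).
Proof.
move=> Fa c; rewrite sipZl -[(l *: F) c]/(l * F c) -mulrBr normrM -mulrA.
by rewrite ler_wpM2l.
Qed.

Lemma approximates_sip a : approximates 0 (s a : V -> R[i]^o) a.
Proof. by move=> c; rewrite subrr normr0 mul0r. Qed.

Lemma approximates_le d d' F a : d <= d' -> approximates d F a -> approximates d' F a.
Proof. by move=> dd Fa b; rewrite (le_trans (Fa b))// ler_wpM2r ?snorm_ge0. Qed.

Lemma approximable_submod : submod_closed approximable.
Proof.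
split.
  apply/asboolP => d d0; exists 0; have := @approximates_sip 0.
  have -> : s 0 = 0 :> (V -> R[i]^o).
    by apply/funext => b /=; rewrite -(scale0r 0) sipZl mul0r.
  by apply: approximates_le; exact: ltW.
move=> l F G /asboolP aF /asboolP aG; apply/asboolP => d d0.
have l1 : 0 < `|l| + 1 by rewrite ltr_wpDl.
have d2 : 0 < d / 2 by rewrite divr_gt0.
have [|a Fa] := aF (d / 2 / (`|l| + 1)); first by rewrite divr_gt0.
have [b Gb] := aG _ d2; exists (l *: a + b).
rewrite [d]splitr; apply: approximatesD => //.
apply: approximates_le (approximatesZ l Fa).
by rewrite mulrA ler_pdivrMr// mulrC ler_pM2l// lerDl.
Qed.

HB.instance Definition _ :=
  GRing.isSubmodClosed.Build _ _ approximable approximable_submod.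

Record completion := Completion {
  cfun :> V -> R[i]^o; _ : cfun \in approximable }.

HB.instance Definition _ := [isSub for cfun].
HB.instance Definition _ := [Choice of completion by <:].
HB.instance Definition _ := [SubChoice_isSubLmodule of completion by <:].

Implicit Types (x y z : completion).

Lemma cfunD x y b : (x + y) b = x b + y b. Proof. by []. Qed.
Lemma cfunZ (l : R[i]) x b : (l *: x) b = l * x b. Proof. by []. Qed.

Lemma completionP x y : (forall b, x b = y b) -> x = y.
Proof. by move=> xy; apply/val_inj/funext. Qed.

Lemma cfun_approx x d : 0 < d -> exists a, approximates d x a.
Proof. by move=> d0; have /asboolP := valP x; exact. Qed.

Lemma cfun_bound x : exists2 M : R[i], 0 <= M & forall b, `|x b| <= M * snorm s b.
Proof.
have [a xa] := cfun_approx x ltr01; exists (1 + snorm s a).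
  by rewrite addr_ge0 ?snorm_ge0.
move=> b; rewrite -(subrK (s a b) (x b)) mulrDl (le_trans (ler_normD _ _))//.
by rewrite lerD// sip_le.
Qed.

(** Membership in [approximable] only bounds the distance to functionals [s c]; additivity passes
    from these to [x]. *)
Lemma cfun_sub x a b : x (a - b) = x a - x b.
Proof.
pose M := snorm s (a - b) + snorm s a + snorm s b.
apply: (@eq_approx _ _ _ M) => d /andP[d0 _].
have [c xc] := cfun_approx x d0.
have -> : x (a - b) - (x a - x b) =
    (x (a - b) - s c (a - b)) - (x a - s c a) + (x b - s c b).
  by rewrite sipDr sipNr; ring.
rewrite /M !mulrDl ![_ * d]mulrC (le_trans (ler_normD _ _))// lerD//.
by rewrite (le_trans (ler_normB _ _))// lerD.
Qed.

Lemma approximates_dist x d d' a b : 0 <= d -> 0 <= d' -> approximates d x a ->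
  approximates d' x b -> snorm s (a - b) <= d + d'.
Proof.
move=> d0 d'0 xa xb; have [->|c0] := eqVneq (snorm s (a - b)) 0.
  exact: addr_ge0.
have {}c0 : 0 < snorm s (a - b) by rewrite lt_def c0 snorm_ge0.
rewrite -(ler_pM2r c0) -expr2 snorm_sq -[leLHS]ger0_norm ?sip_ge0//.
set c := a - b; rewrite {1}/c sipDl sipNl.
have -> : s a c - s b c = - (x c - s a c) + (x c - s b c) by ring.
by rewrite mulrDl (le_trans (ler_normD _ _))// normrN lerD.
Qed.

Lemma approximates_bound x M d a : 0 <= d -> 0 <= M ->
  (forall b, `|x b| <= M * snorm s b) -> approximates d x a ->
  snorm s a <= M + d.
Proof.
move=> d0 M0 xM xa; have [->|c0] := eqVneq (snorm s a) 0.
  exact: addr_ge0.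
have {}c0 : 0 < snorm s a by rewrite lt_def c0 snorm_ge0.
rewrite -(ler_pM2r c0) -expr2 snorm_sq -[leLHS]ger0_norm ?sip_ge0//.
have -> : s a a = x a - (x a - s a a) by ring.
by rewrite mulrDl (le_trans (ler_normB _ _))// lerD.
Qed.

(** The value is the limit of [x a] as [s a] approaches [y]. The error bound, linear in [d] and
    valid for every approximant, determines it and lets later identities be checked on
    approximants. *)
Lemma cinner_exists x y : exists z : R[i], exists M, 0 <= M /\
  forall d a, 0 <= d -> approximates d y a -> `|z - x a| <= M * d.
Proof.
have [M M0 xM] := cfun_bound x.
have /choice[u yu] : forall n, exists a, approximates (harm R n) y a.
  by move=> n; apply: cfun_approx; case/andP: (harm_itv R n).
have h0 n : 0 <= harm R n by apply: ltW; case/andP: (harm_itv R n).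
have xd d d' a b : 0 <= d -> 0 <= d' -> approximates d y a -> approximates d' y b ->
    `|x a - x b| <= M * (d + d').
  move=> d0 d'0 ya yb; rewrite -cfun_sub (le_trans (xM _))//.
  by rewrite ler_wpM2l// (approximates_dist d0 d'0 ya yb).
have [z zu] := @harm_cauchy _ (x \o u) M M0
  (fun n m => xd _ _ _ _ (h0 n) (h0 m) (yu n) (yu m)).
exists z, M; split=> // d a d0 ya; apply/ler_addgt0Pr => eps e0.
have M1 : 0 < M + M + 1 by rewrite ltr_wpDl// addr_ge0.
have [|n /(_ n (leqnn n)) hn] := @harm_small _ (eps / (M + M + 1)).
  by rewrite divr_gt0.
rewrite -(subrK (x (u n)) z) -addrA (le_trans (ler_normD _ _))//.
rewrite (le_trans (lerD (zu n) (xd _ _ _ _ (h0 n) d0 (yu n) ya)))//.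
rewrite mulrDr addrA addrC lerD2l -mulrDl.
rewrite ler_pdivlMr// mulrC in hn; rewrite (le_trans _ hn)//.
by rewrite ler_wpM2r// lerDl.
Qed.

Definition cinner x y : R[i] := projT1 (cid (cinner_exists x y)).

Lemma cinnerP x y : exists2 M, 0 <= M &
  forall d a, 0 <= d -> approximates d y a -> `|cinner x y - x a| <= M * d.
Proof. by rewrite /cinner; case: cid => z [M [M0 h]] /=; exists M. Qed.

Lemma cinner_approx x y : exists2 M, 0 <= M & forall d a b, 0 <= d <= 1 ->
  approximates d x a -> approximates d y b -> `|cinner x y - s a b| <= M * d.
Proof.
have [M M0 xyM] := cinnerP x y; have [N N0 yN] := cfun_bound y.
(* [snorm s b <= N + d <= N + 1]: the restriction [d <= 1] absorbs a quadratic term. *)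
exists (M + (N + 1)); first by rewrite !addr_ge0.
move=> d a b /andP[d0 d1] xa yb.
rewrite -(subrK (x b) (cinner x y)) -addrA mulrDl (le_trans (ler_normD _ _))//.
rewrite lerD// ?xyM// (le_trans (xa b))// mulrC ler_wpM2r//.
by rewrite (le_trans (approximates_bound d0 N0 yN yb))// lerD2l.
Qed.

Lemma cinnerDl x y z : cinner (x + y) z = cinner x z + cinner y z.
Proof.
have [M M0 xM] := cinnerP x z; have [N N0 yN] := cinnerP y z.
have [L L0 xyL] := cinnerP (x + y) z.
apply: (@eq_approx _ _ _ (L + M + N)) => d /andP[d0 _].
have [a za] := cfun_approx z d0; have d0' := ltW d0.
have -> : cinner (x + y) z - (cinner x z + cinner y z) =
    (cinner (x + y) z - (x + y) a) - (cinner x z - x a) - (cinner y z - y a).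
  by rewrite cfunD; ring.
rewrite !mulrDl (le_trans (ler_normB _ _))// lerD ?yN//.
by rewrite (le_trans (ler_normB _ _))// lerD ?xM ?xyL.
Qed.

Lemma cinnerZl (l : R[i]) x y : cinner (l *: x) y = l * cinner x y.
Proof.
have [M M0 xM] := cinnerP x y; have [L L0 xL] := cinnerP (l *: x) y.
apply: (@eq_approx _ _ _ (L + `|l| * M)) => d /andP[d0 _].
have [a ya] := cfun_approx y d0; have d0' := ltW d0.
have -> : cinner (l *: x) y - l * cinner x y =
    (cinner (l *: x) y - (l *: x) a) - l * (cinner x y - x a).
  by rewrite cfunZ; ring.
rewrite !mulrDl (le_trans (ler_normB _ _))// lerD ?xL//.
by rewrite normrM -mulrA ler_wpM2l// xM.
Qed.

Lemma cinnerC x y : cinner y x = (cinner x y)^*%C.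
Proof.
have [M M0 xM] := cinner_approx x y; have [N N0 yN] := cinner_approx y x.
apply: (@eq_approx _ _ _ (M + N)) => d /andP[d0 d1]; have d0' := ltW d0.
have [a xa] := cfun_approx x d0; have [b yb] := cfun_approx y d0.
have -> : cinner y x - (cinner x y)^*%C =
    (cinner y x - s b a) - (cinner x y - s a b)^*%C.
  by rewrite rmorphB/= -sipC; ring.
rewrite addrC mulrDl (le_trans (ler_normD _ _))// lerD//.
  by rewrite normrN norm_conjC xM ?d0'.
by rewrite yN ?d0'.
Qed.

Lemma cinner_ge0 x : 0 <= cinner x x.
Proof.
have [M M0 xM] := cinner_approx x x.
apply: (@ge0_approx _ _ M) => d /andP[d0 d1]; have [a xa] := cfun_approx x d0.
by exists (s a a); [exact: sip_ge0|apply: xM; rewrite ?(ltW d0)].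
Qed.

Definition csip : semi_inner completion :=
  SemiInner cinnerDl cinnerZl cinnerC cinner_ge0.

Lemma embed_subproof a : (s a : V -> R[i]^o) \in approximable.
Proof.
apply/asboolP => d d0; exists a.
by apply: approximates_le (approximates_sip a); exact: ltW.
Qed.

Definition embed a : completion := Completion (embed_subproof a).

Lemma cinner_embed x a : cinner x (embed a) = x a.
Proof.
have [M M0 xM] := cinnerP x (embed a).
apply/eqP; rewrite -subr_eq0 -normr_le0 -(mulr0 M) xM//.
exact: approximates_sip.
Qed.

Definition cnorm x := snorm csip x.

Lemma cfun_le x b : `|x b| <= cnorm x * snorm s b.
Proof.
have <- : snorm csip (embed b) = snorm s b.
  by rewrite /snorm -[csip _ _]/(cinner _ _) cinner_embed.
by rewrite -cinner_embed; exact: sip_le.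
Qed.

(** Together with [cfun_le] this identifies the norm as the dual norm. [x] is tested on an
    approximant [a] of itself: [|x|^2] is close to [x a], and [|x a| <= M |a| <= M (M + d)]. *)
Lemma cnorm_le x M : 0 <= M -> (forall b, `|x b| <= M * snorm s b) -> cnorm x <= M.
Proof.
move=> M0 xM; have [L L0 xL] := cinnerP x x.
rewrite -ler_sqr ?nnegrE ?snorm_ge0// snorm_sq; apply/ler_addgt0Pr => eps e0.
have L1 : 0 < L + M + 1 by rewrite ltr_wpDl// addr_ge0.
have d0 : 0 < eps / (L + M + 1) by rewrite divr_gt0.
set d := eps / _ in d0; have d0' := ltW d0.
have [a xa] := cfun_approx x d0.
rewrite -[leLHS]ger0_norm ?sip_ge0// -[csip _ _]/(cinner x x).
rewrite -(subrK (x a) (cinner x x)) (le_trans (ler_normD _ _))//.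
rewrite (le_trans (lerD (xL _ _ d0' xa) (xM a)))//.
rewrite (le_trans (lerD (lexx _) (ler_wpM2l M0 (approximates_bound d0' M0 xM xa))))//.
rewrite mulrDr addrCA -expr2 lerD2l -mulrDl.
have -> : eps = (L + M + 1) * d by rewrite mulrC divfK// gt_eqF.
by rewrite ler_wpM2r// lerDl.
Qed.

Lemma cnormD x y : cnorm (x + y) <= cnorm x + cnorm y.
Proof. exact: snormD. Qed.

Lemma cnormZ (l : R[i]) x : cnorm (l *: x) = `|l| * cnorm x.
Proof. exact: snormZ. Qed.

Lemma cnorm0_eq0 x : cnorm x = 0 -> x = 0.
Proof.
move=> x0; apply: completionP => b; apply/eqP; rewrite -normr_le0.
by rewrite (le_trans (cfun_le x b))// x0 mul0r.
Qed.

HB.instance Definition _ :=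
  Lmodule_isNormed.Build R[i] completion cnormD cnormZ cnorm0_eq0.

(** The pointwise limits come at a rate proportional to [snorm s b], that is, in the dual norm, so
    the limit is approximable again. *)
Lemma completion_complete (F : set_system completion) :
  ProperFilter F -> cauchy F -> cvg F.
Proof.
move=> FF /cauchyP Fc.
have hgt0 n : 0 < harm R n by case/andP: (harm_itv R n).
have h0 n : 0 <= harm R n by exact: ltW.
have /choice[u Fu] : forall n, exists x, F (ball x (harm R n)).
  by move=> n; exact: Fc.
have uu n m : `|u n - u m| <= harm R n + harm R m.
  have [x []] := filter_ex (filterI (Fu n) (Fu m)).
  rewrite -!ball_normE/= => nx mx.
  rewrite -(subrK x (u n)) -addrA (le_trans (ler_normD _ _))//.
  by rewrite lerD ?(ltW nx)// distrC (ltW mx).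
have uub b n m : `|u n b - u m b| <= snorm s b * (harm R n + harm R m).
  rewrite -[u n b - u m b]/((u n - u m) b) mulrC.
  by rewrite (le_trans (cfun_le _ _))// ler_wpM2r ?snorm_ge0// uu.
have /choice[l lu] : forall b, exists l, forall n, `|l - u n b| <= snorm s b * harm R n.
  by move=> b; apply: harm_cauchy (uub b); exact: snorm_ge0.
have l_approx : (l : V -> R[i]^o) \in approximable.
  apply/asboolP => d d0; have d2 : 0 < d / 2 by rewrite divr_gt0.
  have [n /(_ n (leqnn n)) hn] := harm_small d2.
  have [a ua] := cfun_approx (u n) (hgt0 n); exists a => b.
  rewrite -(subrK (u n b) (l b)) -addrA (le_trans (ler_normD _ _))//.
  rewrite [d]splitr mulrDl lerD//.
    by rewrite (le_trans (lu b n))// mulrC ler_wpM2r// snorm_ge0.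
  by rewrite (le_trans (ua b))// ler_wpM2r// snorm_ge0.
pose x : completion := Completion l_approx.
have xu n : `|x - u n| <= harm R n.
  by apply: cnorm_le => // b; rewrite mulrC; exact: lu.
apply/cvg_ex; exists x; apply/cvgrPdist_le => /= e e0.
have e2 : 0 < e / 2 by rewrite divr_gt0.
have [n /(_ n (leqnn n)) hn] := harm_small e2.
apply: filterS (Fu n) => y; rewrite -ball_normE/= => uy.
rewrite -(subrK (u n) x) -addrA (le_trans (ler_normD _ _))//.
by rewrite [e]splitr lerD// ?(le_trans (xu n))// (le_trans _ hn)// ltW.
Qed.

HB.instance Definition _ := Uniform_isComplete.Build completion completion_complete.

Lemma cinner_norm x : cinner x x = `|x| ^+ 2.
Proof. by rewrite [RHS]snorm_sq. Qed.

HB.instance Definition _ :=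
  isHilbert.Build R completion cinnerDl cinnerZl cinnerC cinner_norm.

Lemma innerE x y : inner x y = cinner x y. Proof. by []. Qed.

Lemma embedD a b : embed (a + b) = embed a + embed b.
Proof. by apply: completionP => c; exact: sipDl. Qed.

Lemma embedZ (l : R[i]) a : embed (l *: a) = l *: embed a.
Proof. by apply: completionP => c; exact: sipZl. Qed.

Lemma embed_dense x d : 0 < d -> exists a, `|x - embed a| <= d.
Proof.
move=> d0; have [a xa] := cfun_approx x d0.
by exists a; apply: cnorm_le => //; exact: ltW.
Qed.

End completion.

(** * Projections in Hilbert spaces *)

Section hilbert.
Variables (R : realType) (H : hilbertType R).
Implicit Types (x y z v w : H) (l : R[i]).

Lemma inner_ge0 x : 0 <= inner x x.
Proof. by rewrite inner_norm exprn_ge0. Qed.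

Definition hsip : semi_inner H :=
  SemiInner (@innerDl R H) (@innerZl R H) (@innerC R H) inner_ge0.

Lemma innerDr x y z : inner x (y + z) = inner x y + inner x z.
Proof. exact: (sipDr hsip). Qed.

Lemma innerZr l x y : inner x (l *: y) = l^*%C * inner x y.
Proof. exact: (sipZr hsip). Qed.

Lemma innerNl x y : inner (- x) y = - inner x y.
Proof. exact: (sipNl hsip). Qed.

Lemma innerNr x y : inner x (- y) = - inner x y.
Proof. exact: (sipNr hsip). Qed.

Lemma innerBl x y z : inner (x - y) z = inner x z - inner y z.
Proof. by rewrite innerDl innerNl. Qed.

Lemma innerBr x y z : inner x (y - z) = inner x y - inner x z.
Proof. by rewrite innerDr innerNr. Qed.

Lemma inner_eq0 x : inner x x = 0 -> x = 0.
Proof. by rewrite inner_norm => /eqP; rewrite sqrf_eq0 normr_eq0 => /eqP. Qed.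

Lemma inner_le x y : `|inner x y| <= `|x| * `|y|.
Proof.
have hn u : snorm hsip u = `|u|.
  by rewrite /snorm -[hsip u u]/(inner u u) inner_norm sqrCK.
by rewrite -!hn; exact: sip_le.
Qed.

Lemma parallelogram x y :
  `|x + y| ^+ 2 + `|x - y| ^+ 2 = 2 * `|x| ^+ 2 + 2 * `|y| ^+ 2.
Proof.
rewrite -!inner_norm !innerDl !innerDr !innerNl !innerNr; ring.
Qed.

Lemma closed_approx (W : set H) x : closed W ->
  (forall d : R[i], 0 < d -> exists2 w, W w & `|x - w| <= d) -> W x.
Proof.
move=> /closure_id cW h; rewrite cW => B /nbhs_ballP[/= d d0 dB].
have d2 : 0 < d / 2 by rewrite divr_gt0.
have [w Ww xw] := h _ d2; exists w; split=> //; apply: dB.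
rewrite -ball_normE/= (le_lt_trans xw)//.
by rewrite [ltRHS]splitr ltrDl.
Qed.

Lemma orthogonal_of_min (W : set H) z : is_subspace W ->
  (forall v, W v -> `|z| <= `|z - v|) -> forall v, W v -> inner z v = 0.
Proof.
move=> [_ _ WZ] zmin v Wv; set c := inner z v; set b := inner v v.
have b0 : 0 <= b by exact: inner_ge0.
have b1 : 0 < b + 1 by rewrite ltr_wpDl.
(* Moving [z] by [- t c v] changes [|z|^2] by [- t |c|^2 (2 - t b)]. This [t] ensures [t b <= 1],
   also when [b = 0]. *)
pose t := (b + 1)^-1; have t0 : 0 < t by rewrite invr_gt0.
have := zmin _ (WZ (t * c) _ Wv).
rewrite -ler_sqr ?nnegrE// -!inner_norm innerBl !innerBr !innerZl !innerZr.
rewrite (innerC z v) -/c -/b rmorphM/= (conjc_ge0 (ltW t0)).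
set a := inner z z; rewrite -subr_ge0.
have -> : a - t * c^*%C * c - (t * c * c^*%C - t * c * (t * c^*%C * b)) - a =
   - (t * (c * c^*%C) * (2 - t * b)) by ring.
rewrite oppr_ge0 => le0.
have tb : 1 <= 2 - t * b.
  have tb1 : t * b <= 1 by rewrite ler_pdivrMl// mulr1 lerDl.
  by rewrite lerBrDr -[2]/(1 + 1) lerD2l.
apply/eqP; rewrite -normr_eq0 -sqrf_eq0 normCK.
have cc : 0 <= c * c^*%C by rewrite -normCK exprn_ge0.
rewrite eq_le cc andbT -(ler_pM2l t0) mulr0 (le_trans _ le0)//.
by rewrite ler_peMr// (mulr_ge0 (ltW t0) cc).
Qed.

Lemma projection (W : set H) x : is_subspace W -> closed W ->
  exists2 w, W w & forall v, W v -> inner (x - w) v = 0.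
Proof.
move=> sW cW; have [W0 WD WZ] := sW.
pose E := [set complex.Re (`|x - w| ^+ 2) | w in W].
have E0 : E !=set0 by exists (complex.Re (`|x - 0| ^+ 2)), 0.
have reE u : (complex.Re (`|u : H| ^+ 2))%:C = `|u| ^+ 2.
  by rewrite RRe_real// ger0_real// exprn_ge0.
have Elb : has_lbound E.
  by exists 0 => _ [w _ <-]; rewrite -lecR reE exprn_ge0.
pose D : R[i] := (inf E)%:C.
have Dle w : W w -> D <= `|x - w| ^+ 2.
  by move=> Ww; rewrite -reE lecR; apply: ge_inf => //; exists w.
have hgt0 n : 0 < harm R n by case/andP: (harm_itv R n).
have /choice[u uP] : forall n, exists w, W w /\ `|x - w| ^+ 2 <= D + harm R n.
  move=> n; have [r r0 rE] := cplx_real_gt0 (hgt0 n).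
  have [_ [w Ww <-] lt] := inf_adherent r0 (conj E0 Elb).
  by exists w; split=> //; rewrite -reE rE -rmorphD lecR ltW.
(* Parallelogram law for [x - u n] and [x - u m]; the midpoint [w] is in [W], so
   [|x - w|^2 >= D]. *)
have uu n m : `|u n - u m| ^+ 2 <= 2 * (harm R n + harm R m).
  have [Wn un] := uP n; have [Wm um] := uP m.
  pose w := 2^-1 *: (u n + u m).
  have Ww : W w by apply/WZ/WD.
  have := parallelogram (x - u n) (x - u m).
  have -> : x - u n + (x - u m) = 2 *: (x - w).
    rewrite scalerBr /w scalerA divff ?pnatr_eq0// scale1r.
    by rewrite scaler_nat mulr2n opprD addrACA.
  have -> : x - u n - (x - u m) = u m - u n by rewrite opprB addrC subrKA.
  rewrite normrZ normr_nat exprMn [X in _ + X ^+ 2]distrC => /(canRL (addKr _)) ->.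
  have -> : 2 * (harm R n + harm R m) =
      - (2 ^+ 2 * D) + (2 * (D + harm R n) + 2 * (D + harm R m)) by ring.
  apply: lerD; first by rewrite lerN2 ler_pM2l ?exprn_gt0// Dle.
  by apply: lerD; rewrite ler_pM2l.
have cu : cvg (u @ \oo).
  apply: cauchy_cvg; apply/cauchy_exP => e e0.
  have e4 : 0 < (e / 2) ^+ 2 / 4 by rewrite !(divr_gt0, exprn_gt0).
  have [n hn] := harm_small e4; exists (u n), n => // m /= nm.
  rewrite -ball_normE/=.
  apply: (@le_lt_trans _ _ (e / 2)); last by rewrite [ltRHS]splitr ltrDl divr_gt0.
  have e2 : 0 <= e / 2 by rewrite divr_ge0// ltW.
  rewrite -ler_sqr ?nnegrE// (le_trans (uu n m))//.
  have -> : (e / 2) ^+ 2 = 2 * ((e / 2) ^+ 2 / 4 + (e / 2) ^+ 2 / 4) by field.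
  by rewrite ler_pM2l// lerD// hn.
move/cvg_ex : cu => [w uw].
have Ww : W w.
  apply: closed_approx => // d d0.
  move/cvgrPdist_le : uw => /(_ _ d0)[N _ /(_ N (leqnn N))] /= h.
  by exists (u N) => //; have [] := uP N.
exists w => //; apply: orthogonal_of_min => // v Wv.
rewrite -addrA -opprD; have {}Wv : W (w + v) by exact: WD.
rewrite -ler_sqr ?nnegrE// (le_trans _ (Dle _ Wv))//.
apply/ler_addgt0Pr => e e0.
have [n hn] := harm_small e0.
have xu m : `|x - u (m + n)%N| ^+ 2 <= D + e.
  by have [_ /le_trans] := uP (m + n)%N; apply; rewrite lerD2l hn// leq_addl.
have De : 0 <= D + e by apply: le_trans (xu 0%N); rewrite exprn_ge0.
rewrite -[D + e]sqrtCK ler_sqr ?nnegrE ?sqrtC_ge0//.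
apply: (@norm_cvg_le _ _ (fun m => x - u (m + n)%N)).
  by apply: cvgB; [exact: cvg_cst|rewrite cvg_shiftn].
by move=> m; rewrite -ler_sqr ?nnegrE ?sqrtC_ge0// sqrtCK.
Qed.

End hilbert.

(** * The GNS representation *)

Section gns.
Variables (R : realType) (A : cstarAlgType R) (e : A).
Hypothesis eU : is_unit e.
Variable f : A -> R.
Hypothesis fpos : positive_functional e f.
Implicit Types a b c : A.

Let flin : rlinear f. Proof. by case: fpos. Qed.

(** [cstar b - b] has hermitian part 0 and is therefore [hpos], for [b = a] as for [b = cstar a]. *)
Lemma functional_star a : f (cstar a) = f a.
Proof.
have h b : f b <= f (cstar b).
  rewrite -subr_ge0 -(rlinearN b flin) -flin.1; apply: fpos.2.
  by rewrite /hpos cstarB cstarK addrC addrA subrK subrr; exact: pos0.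
by apply/eqP; rewrite eq_le h; have := h (cstar a); rewrite cstarK => ->.
Qed.

Definition complexify a : R[i] := (f a)%:C - 'i * (f ('i *: a))%:C.
Local Notation cf := complexify.

Lemma complexifyE a : cf a = f a -i* f ('i *: a).
Proof. by rewrite /cf; simpc. Qed.

Lemma complexifyD a b : cf (a + b) = cf a + cf b.
Proof. by rewrite /cf scalerDr !flin.1 !rmorphD/=; ring. Qed.

Lemma complexifyZ (l : R[i]) a : cf (l *: a) = l * cf a.
Proof.
have cfR (r : R) b : cf (r%:C *: b) = r%:C * cf b.
  have ir : 'i *: (r%:C *: b) = r%:C *: ('i *: b) by rewrite !scalerA mulrC.
  by rewrite /cf ir !flin.2 !rmorphM/=; ring.
have cfI b : cf ('i *: b) = 'i * cf b.
  rewrite /cf scalerA -expr2 sqr_i scaleN1r rlinearN// rmorphN/= mulrBr.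
  by rewrite mulrA -expr2 sqr_i; ring.
have -> : l = (complex.Re l)%:C + 'i * (complex.Im l)%:C.
  by case: l => u v; simpc.
by rewrite scalerDl complexifyD -scalerA cfI !cfR; ring.
Qed.

Lemma complexify_star a : cf (cstar a) = (cf a)^*%C.
Proof.
have fi : f ('i *: cstar a) = - f ('i *: a).
  by rewrite -[in RHS]functional_star cstarZ conjc_i scaleNr rlinearN// opprK.
by rewrite !complexifyE functional_star fi.
Qed.

Lemma complexify_sa a : selfadjoint a -> cf a = (f a)%:C.
Proof.
move=> sa; rewrite /cf.
have : f ('i *: a) = - f ('i *: a).
  by rewrite -{1}functional_star cstarZ conjc_i sa scaleNr rlinearN.
move=> /eqP; rewrite -subr_eq0 opprK -mulr2n mulrn_eq0/= => /eqP ->.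
by rewrite mulr0 subr0.
Qed.

Definition gns_form a b : R[i] := cf (cstar b ** a).

Lemma gns_formDl a b c : gns_form (a + b) c = gns_form a c + gns_form b c.
Proof. by rewrite /gns_form cmulDr complexifyD. Qed.

Lemma gns_formZl (l : R[i]) a b : gns_form (l *: a) b = l * gns_form a b.
Proof. by rewrite /gns_form cmulZr complexifyZ. Qed.

Lemma gns_formC a b : gns_form b a = (gns_form a b)^*%C.
Proof. by rewrite /gns_form -complexify_star cstarM cstarK. Qed.

Lemma gns_formE a : gns_form a a = (f (cstar a ** a))%:C.
Proof. by rewrite /gns_form complexify_sa//; exact: sa_starM. Qed.

Lemma functional_starM_ge0 a : 0 <= f (cstar a ** a).
Proof. by apply: fpos.2; apply/hpos_pos/pos_starM. Qed.

Lemma gns_form_ge0 a : 0 <= gns_form a a.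
Proof. by rewrite gns_formE ler0c functional_starM_ge0. Qed.

Definition gns_sip : semi_inner A :=
  SemiInner gns_formDl gns_formZl gns_formC gns_form_ge0.

Lemma gns_formM a b c : gns_form (a ** b) c = gns_form b (cstar a ** c).
Proof. by rewrite /gns_form cstarM cstarK cmulA. Qed.

(** [|a|^2 - a^* a] is a square [z^2]; nonnegativity of the form at [z b] is the claim. *)
Lemma gns_snormM a b : snorm gns_sip (a ** b) <= `|a| * snorm gns_sip b.
Proof.
rewrite -ler_sqr ?nnegrE ?mulr_ge0 ?snorm_ge0// exprMn !snorm_sq.
rewrite -[gns_sip _ _]/(gns_form _ _) -[gns_sip b b]/(gns_form _ _).
have sa : selfadjoint (cstar a ** a) by exact: sa_starM.
have [z [[sz _] zz _]] := pos_sqrt eU (pos_norm_sub eU sa).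
have := gns_form_ge0 (z ** b).
rewrite gns_formM sz cmulA zz normc_cstarM cmulBl cmulZl (cmul1l eU).
have formE u v : gns_form u v = gns_sip u v by [].
rewrite formE sipDr sipZr sipNr conjc_ge0 ?exprn_ge0// subr_ge0.
by rewrite gns_formM -cmulA.
Qed.

Definition gns_space : hilbertType R := completion gns_sip.
Implicit Types F G : gns_space.

Lemma gns_subproof a F : (fun b => F (cstar a ** b)) \in approximable gns_sip.
Proof.
apply/asboolP => d d0; have a1 : 0 < `|a| + 1 by rewrite ltr_wpDl.
have [c Fc] := cfun_approx F (divr_gt0 d0 a1); exists (a ** c) => b.
rewrite -[gns_sip _ _]/(gns_form _ _) gns_formM (le_trans (Fc _))//.
rewrite (le_trans (ler_wpM2l _ (gns_snormM _ _)))// ?(ltW (divr_gt0 _ _))//.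
rewrite mulrA ler_wpM2r ?snorm_ge0// norm_cstar mulrAC ler_pdivrMr//.
by rewrite ler_pM2l// lerDl.
Qed.

(** On [embed c] this is left multiplication by [a], since the form satisfies
    [s c (a^* b) = s (a c) b]. *)
Definition gns a F : gns_space := Completion (gns_subproof a F).

Lemma gnsE a F b : gns a F b = F (cstar a ** b). Proof. by []. Qed.

Lemma gns_norm a F : `|gns a F| <= `|a| * `|F|.
Proof.
apply: cnorm_le => [|b]; first by rewrite mulr_ge0.
rewrite gnsE (le_trans (cfun_le _ _))// [`|a| * _]mulrC -mulrA.
by rewrite ler_wpM2l ?snorm_ge0// -(norm_cstar a) gns_snormM.
Qed.

Lemma gns_linear a : linear (gns a).
Proof. by move=> l F G; exact: completionP. Qed.

Lemma gns_bounded a : is_bounded_op (gns a).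
Proof. by split; [exact: gns_linear|exists `|a|; exact: gns_norm]. Qed.

Lemma gnsDl (l : R[i]) a b F : gns (l *: a + b) F = l *: gns a F + gns b F.
Proof.
apply: completionP => c; rewrite cfunD cfunZ !gnsE -!cinner_embed.
rewrite cstarD cstarZ cmulDl cmulZl embedD embedZ.
rewrite -!innerE innerDr innerZr; congr (_ * _ + _).
exact: conjcK.
Qed.

Lemma gnsD a b F : gns (a + b) F = gns a F + gns b F.
Proof. by have := gnsDl 1 a b F; rewrite !scale1r. Qed.

Lemma gnsZ (l : R[i]) a F : gns (l *: a) F = l *: gns a F.
Proof.
have g0 : gns 0 F = 0 by apply: (addrI (gns 0 F)); rewrite -gnsD !addr0.
by have := gnsDl l a 0 F; rewrite g0 !addr0.
Qed.

Lemma gnsM a b F : gns (a ** b) F = gns a (gns b F).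
Proof. by apply: completionP => c; rewrite !gnsE cstarM cmulA. Qed.

Lemma gns_adjoint a : adjoint (gns a) (gns (cstar a)).
Proof.
move=> F G; rewrite !innerE.
have [M M0 FM] := cinnerP (gns a F) G.
have [N N0 FN] := cinnerP F (gns (cstar a) G).
apply: (@eq_approx _ _ _ (M + N * `|a|)) => d /andP[d0 _].
have [c Gc] := cfun_approx G d0; have d0' := ltW d0.
have Gc' : approximates gns_sip (`|a| * d) (gns (cstar a) G) (cstar a ** c).
  move=> b; rewrite gnsE cstarK -[gns_sip _ _]/(gns_form _ _) gns_formM cstarK.
  rewrite (le_trans (Gc _))// [`|a| * d]mulrC -mulrA ler_wpM2l//.
  exact: gns_snormM.
have -> : cinner (gns a F) G - cinner F (gns (cstar a) G) =
  (cinner (gns a F) G - gns a F c) - (cinner F (gns (cstar a) G) - F (cstar a ** c)).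
  by rewrite gnsE; ring.
rewrite mulrDl (le_trans (ler_normB _ _))// lerD ?FM//.
by rewrite -mulrA FN// mulr_ge0.
Qed.

Lemma gns_unit e' F : is_unit e' -> gns e' F = F.
Proof.
move=> eU'; apply: completionP => b.
by rewrite gnsE (sa_unit eU') (cmul1l eU').
Qed.

Definition gns_vector : gns_space := embed gns_sip e.

Lemma gns_vectorE a : gns a gns_vector = embed gns_sip a.
Proof.
apply: completionP => b; rewrite gnsE -[LHS]/(gns_form _ _) -[RHS]/(gns_form _ _).
by rewrite -[in LHS](cstarK a) -gns_formM cstarK (cmul1r eU).
Qed.

Lemma inner_gns_vector a : inner (gns a gns_vector) gns_vector = cf a.
Proof.
rewrite gns_vectorE innerE cinner_embed.
by rewrite -[LHS]/(gns_form _ _) /gns_form (sa_unit eU) (cmul1l eU).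
Qed.

Lemma inner_gns_embed F b : inner F (gns b gns_vector) = F b.
Proof. by rewrite gns_vectorE innerE cinner_embed. Qed.

(** Split the cyclic vector as [xi = w + z] with [w] in [W] and [z] orthogonal to [W]. Invariance
    kills the mixed terms, so the vector functionals of [w] and [z] add up to [f], and purity makes
    [w = c xi]. If [c = 0], then [W] is orthogonal to all [a xi]; otherwise [xi], and with it a
    dense subspace, lies in [W]. *)
Lemma gns_irreducible : pure e f -> f e = 1 ->
  forall W : set gns_space, is_subspace W -> closed W ->
    (forall a F, W F -> W (gns a F)) -> W = [set 0] \/ W = setT.
Proof.
move=> fpure fe W sW cW WA; have [W0 WD WZ] := sW.
have [w Ww] := projection gns_vector sW cW.
have : gns_vector = w + (gns_vector - w) by rewrite addrC subrK.
move: (_ - w) => z xiE wP.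
have zW v : W v -> inner v z = 0.
  by move=> Wv; rewrite (innerC z v) wP// rmorph0.
pose vf (v : gns_space) a := complex.Re (inner (gns a v) v).
have vf_pos v : positive_functional e (vf v).
  have vflin : rlinear (vf v).
    split=> [a b|r a]; first by rewrite /vf gnsD innerDl raddfD.
    rewrite /vf gnsZ innerZl.
    by case: (inner _ _) => p q /=; rewrite mul0r subr0.
  split=> // a pa.
  have [y [[sy _] yy _]] := pos_sqrt eU pa.
  have vs : vf v (cstar a) = vf v a.
    rewrite /vf gns_adjoint cstarK (innerC (gns a v) v).
    by case: (inner _ _).
  have : 0 <= vf v a + vf v a.
    rewrite -[X in _ + X]vs -vflin.1 -yy /vf gnsM gns_adjoint sy.
    by rewrite -lecR RRe_real ?ger0_real ?inner_ge0.
  by rewrite -mulr2n pmulrn_lge0.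
have fE a : f a = complex.Re (inner (gns a gns_vector) gns_vector).
  by rewrite inner_gns_vector complexifyE.
have vfD a : vf w a + vf z a = f a.
  rewrite fE xiE.
  have -> : gns a (w + z) = gns a w + gns a z.
    by have := gns_linear a 1 w z; rewrite !scale1r.
  rewrite !innerDl !innerDr (zW (gns a w)); last exact: WA.
  rewrite (gns_adjoint a z w) (wP (gns (cstar a) w)); last exact: WA.
  by rewrite addr0 add0r raddfD.
have key a := fpure _ _ (vf_pos w) (vf_pos z) vfD a.
set c := vf w e in key.
have keyC a : inner (gns a w) w = c%:C * inner (gns a gns_vector) gns_vector.
  have re := key a; have im := key ('i *: a).
  move: re im; rewrite !fE /vf !gnsZ !innerZl.
  case: (inner (gns a w) w) => p q; case: (inner (gns a gns_vector) gns_vector) => u v.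
  rewrite /= !mul0r !mul1r !sub0r mulrN => -> /oppr_inj ->.
  by simpc.
(* [b^* w] is in [W], so it has the same inner product with [xi] as with [w], and [keyC] evaluates
   the latter. *)
have wxi : w = c%:C *: gns_vector.
  apply: completionP => b; rewrite cfunZ -!inner_gns_embed.
  have := keyC (cstar b); rewrite !gns_adjoint !cstarK => <-.
  rewrite -[b in LHS]cstarK -gns_adjoint xiE innerDr zW ?addr0; last exact: WA.
  by rewrite gns_adjoint cstarK.
have [c0|c0] := eqVneq c 0; [left|right].
  apply/seteqP; split=> [v Wv|v ->] //=; apply: completionP => b.
  rewrite -inner_gns_embed -[b]cstarK -gns_adjoint.
  have -> : gns_vector = z by rewrite xiE wxi c0 scale0r add0r.
  by rewrite zW//; exact: WA.
apply/seteqP; split=> // v _; apply: closed_approx => // d d0.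
have [a va] := embed_dense v d0; exists (embed gns_sip a) => //.
rewrite -gns_vectorE; apply: WA.
have -> : gns_vector = (c^-1)%:C *: w.
  by rewrite wxi scalerA -rmorphM mulVf// scale1r.
exact: WZ.
Qed.

End gns.

(** * Separation *)

Section star_action.
Variables (R : realType) (B : cstarAlgType R) (e : B).
Hypothesis eU : is_unit e.
Implicit Types (a b n x y : B).

(** Common to representations of a unital algebra and to the extension [unit_op] to a unitization,
    so one separation argument serves both. *)
Definition star_action (H : hilbertType R) (op : B -> H -> H) :=
  [/\ forall a, linear (op a),
      forall (l : R[i]) a b v, op (l *: a + b) v = l *: op a v + op b v,
      forall a b v, op (a ** b) v = op a (op b v),
      forall a, adjoint (op a) (op (cstar a))
    & forall v, op e v = v].

Section action.
Variables (H : hilbertType R) (op : B -> H -> H).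
Hypothesis opA : star_action op.
Implicit Types v : H.

Let opM a b v : op (a ** b) v = op a (op b v). Proof. by case: opA. Qed.
Let op_adj a : adjoint (op a) (op (cstar a)). Proof. by case: opA. Qed.
Let op1 v : op e v = v. Proof. by case: opA. Qed.

Let opD a b v : op (a + b) v = op a v + op b v.
Proof. by case: opA => _ /(_ 1 a b v); rewrite !scale1r. Qed.

Let op0 v : op 0 v = 0.
Proof. by apply: (addrI (op 0 v)); rewrite -opD !addr0. Qed.

Lemma actionZ (l : R[i]) a v : op (l *: a) v = l *: op a v.
Proof. by case: opA => _ /(_ l a 0 v); rewrite op0 !addr0. Qed.

Let opN a v : op (- a) v = - op a v.
Proof. by rewrite -scaleN1r actionZ scaleN1r. Qed.

Lemma actionB a b v : op (a - b) v = op a v - op b v.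
Proof. by rewrite opD opN. Qed.

Lemma action_scale a (l : R[i]) v : op a (l *: v) = l *: op a v.
Proof.
case: opA => /(_ a) lin _ _ _ _.
have l0 : op a 0 = 0.
  have := lin 1 0 0; rewrite !scale1r addr0 => h.
  by apply: (addrI (op a 0)); rewrite -h addr0.
by have := lin l v 0; rewrite l0 !addr0.
Qed.

Lemma action0 a : op a 0 = 0.
Proof. by have := action_scale a 0 0; rewrite !scale0r. Qed.

Lemma action_norm_sq y v : inner (op (cstar y ** y) v) v = `|op y v| ^+ 2.
Proof. by rewrite opM op_adj cstarK inner_norm. Qed.

(* [op n (op x (op n v)) = - op n^3 v], so positivity of [op x] kills the
   negative part of [x]. *)
Lemma action_neg_part x n k : selfadjoint n -> selfadjoint k ->
  n ** x = - (n ** n) -> k ** k = n ** n ** n ->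
  (forall v, 0 <= inner (op x v) v) -> forall v, op n v = 0.
Proof.
move=> sn sk nx kk xpos v.
have nnn0 u : op (n ** n ** n) u = 0.
  rewrite -kk opM; have -> : op k u = 0; last exact: action0.
  apply: inner_eq0; apply/eqP; rewrite eq_le inner_ge0 andbT.
  have := xpos (op n u); rewrite -[X in inner _ (op X u)]sn -op_adj -!opM nx.
  by rewrite cmulNl -kk opN innerNl oppr_ge0 -{1}sk action_norm_sq inner_norm.
have sq0 y u : selfadjoint y -> op (y ** y) u = 0 -> op y u = 0.
  move=> sy yy0; apply/normr0_eq0/eqP; rewrite -sqrf_eq0 -action_norm_sq sy yy0.
  by rewrite -(scale0r u) innerZl mul0r.
apply: (sq0) => //; apply: sq0; first exact: saM.
by rewrite cmulA opM nnn0.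
Qed.

End action.

Lemma state_exists y :
  (forall d : R[i], 0 < d -> ~ pos e (cstar y ** y - d *: e)) ->
  exists f : B -> R, [/\ positive_functional e f, f e = 1,
    f (cstar y ** y) = 0 & pure e f].
Proof.
move=> npos; apply: pure_state_exists => //.
  by apply: hpos_pos => //; exact: pos_starM.
move=> d d0; have dC : 0 < d%:C :> R[i] by rewrite ltcR.
have sx : selfadjoint (cstar y ** y - d%:C *: e).
  by apply: saB; [exact: sa_starM|apply: saZ; [exact: ltW|exact: sa_unit]].
rewrite /hpos sx => px; apply: (npos _ dC).
by rewrite -[X in pos e X]half_add; apply: (posZ eU) px; rewrite invr_ge0.
Qed.

Section transfer.
Variable f : B -> R.
Hypotheses (fpos : positive_functional e f) (f1 : f e = 1).

Let xi := gns_vector eU fpos.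

Lemma gns_null y : f (cstar y ** y) = 0 -> gns y xi = 0.
Proof.
move=> fy; rewrite gns_vectorE; apply: inner_eq0.
rewrite innerE cinner_embed.
by rewrite -[LHS]/(gns_form _ _ _) (gns_formE eU fpos) fy.
Qed.

Lemma functional_gns_eq0 n : gns n xi = 0 -> f n = 0.
Proof.
move=> nxi; have := inner_gns_vector eU fpos n; rewrite -/xi nxi complexifyE.
rewrite -(scale0r xi) innerZl mul0r => /eqP.
by rewrite eq_complex/= => /andP[/eqP].
Qed.

Lemma no_lower_bound (H : hilbertType R) (op : B -> H -> H) y :
  star_action op -> f (cstar y ** y) = 0 ->
  (forall n, (forall v, op n v = 0) -> gns n xi = 0) ->
  forall d : R[i], 0 < d -> ~ forall v, d * `|v| ^+ 2 <= `|op y v| ^+ 2.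
Proof.
move=> opA fy kersub d d0 lb; set x := cstar y ** y - d *: e.
have sx : selfadjoint x.
  by apply: saB; [exact: sa_starM|apply: saZ; [exact: ltW|exact: sa_unit]].
have [n [k [sn sk pm nx kk]]] := neg_part eU sx.
have xpos v : 0 <= inner (op x v) v.
  rewrite actionB// actionZ// innerBl innerZl action_norm_sq//.
  by have [_ _ _ _ ->] := opA; rewrite inner_norm subr_ge0.
have n0 : f n = 0.
  by apply: functional_gns_eq0; apply: kersub; exact: action_neg_part nx kk xpos.
have [lf pf] := fpos.
(* [f (x + 2 n) >= 0] and [f n = 0], whereas [f x = - d]. *)
have := pf _ (hpos_pos pm); rewrite lf.1.
have [r r0 dr] := cplx_real_gt0 d0.
have two : 2 = (2 : R)%:C by rewrite rmorph_nat.
rewrite two lf.2 n0 mulr0 addr0 /x lf.1 fy add0r rlinearN// dr lf.2 f1 mulr1.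
by rewrite oppr_ge0 leNgt r0.
Qed.

End transfer.

Lemma pos_scale_unit (c : R[i]) : c \is Num.real -> pos e (c *: e) -> 0 <= c.
Proof.
move=> cR pc; rewrite real_leNgt ?real0//; apply/negP => c0.
have /(pos_anti eU pc) /eqP : pos e (- (c *: e)).
  by rewrite -scaleNr; apply: (posZ eU) (pos1 eU); rewrite oppr_ge0 ltW.
by rewrite scaler_eq0 (negbTE eU.1) orbF lt_eqF.
Qed.

Section family.
Variables (I : Type) (H : I -> hilbertType R) (op : forall i, B -> H i -> H i).
Arguments op : clear implicits.
Hypothesis opA : forall i, star_action (op i).

Lemma op_invertible_bounded_below i a : op_invertible (op i a) ->
  exists2 d : R[i], 0 < d & forall v, d * `|v| ^+ 2 <= `|op i a v| ^+ 2 /\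
    d * `|v| ^+ 2 <= `|op i (cstar a) v| ^+ 2.
Proof.
move=> [S [[_ [M SM]] TS ST]].
(* On the zero space [M] can be any complex number, hence [|M|]; later [|M| + 1] is invertible even
   if [M = 0]. *)
have SM' v : `|S v| <= `|M| * `|v|.
  rewrite -[`|v|]normr_id -normrM -[leLHS]normr_id.
  rewrite [leRHS]ger0_norm; last exact: le_trans (SM v).
  by rewrite normr_id.
have M1 : 0 < (`|M| + 1) ^+ 2 by rewrite exprn_gt0// ltr_wpDl.
have bound u v : `|v| <= `|M| * `|u| ->
    ((`|M| + 1) ^+ 2)^-1 * `|v| ^+ 2 <= `|u| ^+ 2.
  move=> vu; rewrite ler_pdivrMl// -exprMn ler_sqr ?nnegrE ?mulr_ge0 ?addr_ge0//.
  by rewrite (le_trans vu)// ler_wpM2r// lerDl.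
exists ((`|M| + 1) ^+ 2)^-1; first by rewrite invr_gt0.
move=> v; split; apply: bound; first by rewrite -{1}(TS v).
have [->|v0] := eqVneq v 0; first by rewrite normr0 mulr_ge0.
have {}v0 : 0 < `|v| by rewrite normr_gt0.
have [_ _ _ adj _] := opA i.
rewrite -(ler_pM2l v0) -expr2 -inner_norm -{1}(ST v) adj.
rewrite -[leLHS]ger0_norm; last first.
  by rewrite -adj ST inner_ge0.
rewrite (le_trans (inner_le _ _))// mulrA [`|v| * _]mulrC ler_wpM2r//.
Qed.

Lemma family_invertible a :
  (forall y, y = a \/ y = cstar a ->
    (forall d : R[i], 0 < d -> ~ pos e (cstar y ** y - d *: e)) ->
    exists i, forall d : R[i], 0 < d ->
      ~ forall v, d * `|v| ^+ 2 <= `|op i y v| ^+ 2) ->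
  (forall i, op_invertible (op i a)) -> invertible e a.
Proof.
move=> sep ainv.
have inv y : y = a \/ y = cstar a -> invertible e (cstar y ** y).
  move=> ya; have [[d [d0 pd]]|npd] :=
      pselect (exists d : R[i], 0 < d /\ pos e (cstar y ** y - d *: e)).
    exact: invertible_pos d0 pd.
  have [|i hi] := sep _ ya; first by move=> d d0 pd; apply: npd; exists d.
  have [d d0 lb] := op_invertible_bounded_below (ainv i).
  by case: (hi _ d0) => v; case: ya => ->; have [] := lb v.
apply: (invertible_of_starM eU); first by apply: inv; left.
by have := inv (cstar a); rewrite cstarK; apply; right.
Qed.

(** Since [|y v|^2 = |a|^2 |v|^2 - |a v|^2], the norm of [op i a] drops below [|a|] only if [op i y]
    is bounded below. In the algebra itself, [y^2 >= d] would give [|a|^2 <= |a|^2 - d]. *)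
Lemma family_norming a :
  (forall y, selfadjoint y -> y ** y = `|a| ^+ 2 *: e - cstar a ** a ->
    (forall d : R[i], 0 < d -> ~ pos e (cstar y ** y - d *: e)) ->
    exists i, forall d : R[i], 0 < d ->
      ~ forall v, d * `|v| ^+ 2 <= `|op i y v| ^+ 2) ->
  exists i, `|a| = opnorm (op i a).
Proof.
move=> sep; have saa : selfadjoint (cstar a ** a) by exact: sa_starM.
have [y [[sy _] yy _]] := pos_sqrt eU (pos_norm_sub eU saa).
rewrite normc_cstarM in yy.
have opy i v : `|op i y v| ^+ 2 = `|a| ^+ 2 * `|v| ^+ 2 - `|op i a v| ^+ 2.
  rewrite -action_norm_sq// sy yy actionB// actionZ// innerBl innerZl action_norm_sq//.
  by have [_ _ _ _ ->] := opA i; rewrite inner_norm.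
have [|i hi] := sep _ sy yy.
  move=> d d0; rewrite sy yy => pd.
  have pc : pos e ((`|a| ^+ 2 - d) *: e - cstar a ** a).
    by move: pd; rewrite scalerBl addrAC.
  have cR : `|a| ^+ 2 - d \is Num.real 
    by rewrite rpredB ?rpredX ?normr_real ?gtr0_real.
  have c0 : 0 <= `|a| ^+ 2 - d.
    apply: pos_scale_unit => //; rewrite -[X in pos e X](subrK (cstar a ** a)).
    by apply: posD pc _ => //; exact: pos_starM.
  have := pos_norm_le eU c0 (pos_starM eU a) pc; rewrite normc_cstarM.
  by rewrite lerBrDr gerDl (lt_geF d0).
have contr v : `|op i a v| <= `|a| * `|v|.
  rewrite -ler_sqr ?nnegrE ?mulr_ge0// exprMn -subr_ge0 -opy.
  by rewrite exprn_ge0.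
exists i; apply/eqP; rewrite eq_le; apply/andP; split; last first.
  apply: opnorm_le => // [|v v1]; first exact: (action0 (opA i)).
  by rewrite (le_trans (contr v))// ler_piMr.
have contr1 v : `|v| <= 1 -> `|op i a v| <= `|a|.
  by move=> v1; rewrite (le_trans (contr v))// ler_piMr.
have q0 : 0 <= opnorm (op i a).
  have := opnorm_ge (normr_ge0 a) contr1; move=> /(_ 0); rewrite normr0 ler01.
  by move=> /(_ isT); exact: le_trans.
rewrite real_leNgt ?ger0_real//; apply/negP => qa.
have d0 : 0 < `|a| ^+ 2 - opnorm (op i a) ^+ 2.
  by rewrite subr_gt0 ltr_sqr ?nnegrE.
apply: (hi _ d0) => v; rewrite opy mulrBl lerD2l lerN2.
rewrite -exprMn ler_sqr ?nnegrE ?mulr_ge0//.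
apply: opnormP contr1 => //; move=> l w; exact: (action_scale (opA i)).
Qed.

End family.
End star_action.

(** * Exhausting families *)

Lemma invertible_op (R : realType) (B : cstarAlgType R) (e : B)
    (H : hilbertType R) (op : B -> H -> H) a :
  star_action e op -> (forall b, is_bounded_op (op b)) ->
  invertible e a -> op_invertible (op a).
Proof.
move=> [_ _ opM _ op1] opB [b [ab ba]]; exists (op b); split=> // v.
  by rewrite -opM ba op1.
by rewrite -opM ab op1.
Qed.

(** * The unital case *)

Section unital.
Variables (R : realType) (A : cstarAlgType R) (e : A).
Hypothesis eU : is_unit e.
Implicit Types a y : A.

Lemma representation_action (phi : representation A) : star_action e phi.
Proof.
split.
- by move=> a; have [] := rep_bounded phi a.
- exact: rep_linear.
- exact: rep_mul.
- exact: rep_star.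
- exact: rep_unit.
Qed.

Definition gns_representation f (fpos : positive_functional e f) :
    representation A :=
  @Representation R A (gns_space eU fpos) (@gns _ _ _ eU _ fpos)
    (@gns_bounded _ _ _ eU _ fpos)
    (@gnsDl _ _ _ eU _ fpos) (@gnsM _ _ _ eU _ fpos)
    (@gns_adjoint _ _ _ eU _ fpos)
    (fun e' eU' F => gns_unit F eU').

Variables (I : choiceType) (F : I -> representation A).
Hypothesis exh : exhausting F.

Lemma unital_separation y :
  (forall d : R[i], 0 < d -> ~ pos e (cmul (cstar y) y - d *: e)) ->
  exists i, forall d : R[i], 0 < d ->
    ~ forall v, d * `|v| ^+ 2 <= `|F i y v| ^+ 2.
Proof.
move=> /(state_exists eU)[f [fpos f1 fy fpure]].
have irr : irreducible (gns_representation fpos).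
  split; last by move=> W sW cW WA; exact: gns_irreducible WA.
  exists e, (gns_vector eU fpos); apply/eqP => exi.
  by have := functional_gns_eq0 exi; rewrite f1 => /eqP; rewrite oner_eq0.
have [i ker] := exh irr; exists i => d d0.
have kerE n : (forall v, F i n v = 0) -> gns n (gns_vector eU fpos) = 0.
  by move=> /ker; exact.
exact: (no_lower_bound f1 (representation_action (F i)) fy kerE d0).
Qed.

Lemma unital_invertible a :
  invertible e a <-> forall i, op_invertible (F i a).
Proof.
split=> [ainv i|].
  apply: invertible_op ainv; [exact: representation_action|exact: rep_bounded].
apply: (family_invertible eU (fun i => representation_action (F i))) => y _.
exact: unital_separation.
Qed.

Lemma unital_norming a : exists i, `|a| = opnorm (F i a).
Proof.
apply: (family_norming eU (fun i => representation_action (F i))) => y _ _.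
exact: unital_separation.
Qed.

End unital.

(** * The non-unital case, inside the unitization *)

Section nonunital.
Variables (R : realType) (A : cstarAlgType R).
Notation Ap := (unitization A).
Implicit Types (a b : A) (x y : Ap).

Let one : Ap := adj 0 1.
Let oneU : is_unit one := unitization_unit A.

(** The unital extension of [phi] to [A^+], also for degenerate [phi]. *)
Definition unit_op (phi : representation A) x (v : rep_space phi) :=
  x.2 *: v + phi x.1 v.
Arguments unit_op : clear implicits.

Section unit_op.
Variable phi : representation A.

Let phiD a b v : phi (a + b) v = phi a v + phi b v.
Proof. by have := rep_linear 1 a b v; rewrite !scale1r. Qed.

Let phi0 v : phi 0 v = 0.
Proof. by apply: (addrI (phi 0 v)); rewrite -phiD !addr0. Qed.

Let phiZ (l : R[i]) a v : phi (l *: a) v = l *: phi a v.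
Proof. by have := rep_linear l a 0 v; rewrite phi0 !addr0. Qed.

Let phi_linear a : linear (phi a).
Proof. by have [] := rep_bounded phi a. Qed.

Lemma unit_op_linear x : linear (unit_op phi x).
Proof.
move=> l u v; rewrite /unit_op phi_linear !scalerDr !scalerA [l * _]mulrC.
by rewrite addrACA.
Qed.

Lemma unit_op_action : star_action one (unit_op phi).
Proof.
have phi_scale a (l : R[i]) v : phi a (l *: v) = l *: phi a v.
  have p0 : phi a 0 = 0.
    have := phi_linear a 1 0 0; rewrite !scale1r addr0 => h.
    by apply: (addrI (phi a 0)); rewrite -h addr0.
  by have := phi_linear a l v 0; rewrite p0 !addr0.
have phi_add a u v : phi a (u + v) = phi a u + phi a v.
  by have := phi_linear a 1 u v; rewrite !scale1r.
split.
- exact: unit_op_linear.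
- move=> l x y v; rewrite /unit_op /= phiD phiZ scalerDl scalerDr -scalerA.
  by rewrite addrACA.
- move=> x y v; rewrite /unit_op /= !phiD !phiZ rep_mul phi_add phi_scale.
  rewrite scalerDr scalerA -[RHS]addrA; congr (_ + _).
  by rewrite [_ + y.2 *: _]addrC [phi x.1 _ + _]addrC addrCA.
- move=> x u v; rewrite /unit_op innerDl innerDr innerZl innerZr rep_star.
  by rewrite conjcK.
- by move=> v; rewrite /unit_op /= phi0 scale1r addr0.
Qed.

Lemma unit_op_bounded x : is_bounded_op (unit_op phi x).
Proof.
split; first exact: unit_op_linear.
have [_ [M phiM]] := rep_bounded phi x.1.
exists (`|x.2| + M) => v; rewrite (le_trans (ler_normD _ _))// mulrDl.
by rewrite normrZ lerD2l.
Qed.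

End unit_op.

Lemma adjD (l : R[i]) a b : adj (l *: a + b) 0 = l *: adj a 0 + adj b 0 :> Ap.
Proof. by apply: unit_pairP => //=; rewrite addr0; apply/esym; exact: mulr0. Qed.

Lemma adjM a b : adj (cmul a b) 0 = cmul (adj a 0 : Ap) (adj b 0 : Ap) :> Ap.
Proof. by apply: unit_pairP => /=; rewrite ?scale0r ?addr0 ?mulr0. Qed.

Lemma adj_star a : adj (cstar a) 0 = cstar (adj a 0 : Ap) :> Ap.
Proof. by apply: unit_pairP => //=; exact/esym/conjc0. Qed.

Lemma adjE x : x = adj x.1 0 + x.2 *: one.
Proof.
apply: unit_pairP => /=; first by rewrite scaler0 addr0.
by rewrite add0r; apply/esym; exact: mulr1.
Qed.

Hypothesis nonunital : ~ unital A.

Section restriction.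
Variables (f : Ap -> R) (fpos : positive_functional one f).

Let H := gns_space oneU fpos.

Let res a (v : H) : H := gns (adj a 0 : Ap) v.

Let res_linear (l : R[i]) a b v : res (l *: a + b) v = l *: res a v + res b v.
Proof. by rewrite /res adjD gnsDl. Qed.

Let res_mul a b v : res (cmul a b) v = res a (res b v).
Proof. by rewrite /res adjM gnsM. Qed.

Let res_star a : adjoint (res a) (res (cstar a)).
Proof. by rewrite /res adj_star; exact: gns_adjoint. Qed.

Let res_unit e : is_unit e -> forall v, res e v = v.
Proof. by move=> eU; case: nonunital; exists e. Qed.

Definition gns_restriction : representation A :=
  @Representation R A H res (fun a => @gns_bounded _ _ _ oneU _ fpos (adj a 0 : Ap))
    res_linear res_mul res_star res_unit.

Hypotheses (f1 : f one = 1) (fpure : pure one f).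

Let xi := gns_vector oneU fpos.

(* A vector annihilated by [y] with nonzero scalar part lies in [A xi]. *)
Let xi_res y : y.2 != 0 -> gns y xi = 0 -> xi = res (- y.2^-1 *: y.1) xi.
Proof.
move=> y2 yxi; rewrite /res.
have -> : adj (- y.2^-1 *: y.1) 0 = one - y.2^-1 *: y :> Ap.
  apply: unit_pairP => /=; first by rewrite add0r scaleNr.
  by apply/esym/eqP; rewrite subr_eq0; apply/eqP/esym; exact: mulVf.
by rewrite gnsD -scaleNr gnsZ yxi scaler0 addr0 gns_unit.
Qed.

(** The nonzero vector [xi] lies in [A xi], so [A] acts nontrivially; and as scalars preserve
    subspaces, [A]-invariant ones are [A^+]-invariant. *)
Lemma gns_restriction_irreducible y : y.2 != 0 -> gns y xi = 0 ->
  irreducible gns_restriction.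
Proof.
move=> y2 yxi; split.
  exists (- y.2^-1 *: y.1), xi; rewrite -[X in X != _]/(res _ _) -xi_res//.
  apply/eqP => xi0; have : gns one xi = 0 by rewrite gns_unit.
  by move=> /functional_gns_eq0; rewrite f1 => /eqP; rewrite oner_eq0.
move=> W sW cW WA; apply: gns_irreducible => // x v Wv.
have [W0 WD WZ] := sW.
rewrite (adjE x) gnsD gnsZ (gns_unit v oneU); apply: WD; last exact: WZ.
exact: WA.
Qed.

(** Choose [d] in [A] with [xi = d xi]. The product [n d] lies in [A] and is killed by [phi], so the
    kernel inclusion on [A] gives [n xi = n d xi = 0]. *)
Lemma gns_restriction_ker y (phi : representation A) n :
  y.2 != 0 -> gns y xi = 0 -> rep_ker phi `<=` rep_ker gns_restriction ->
  (forall v, unit_op phi n v = 0) -> gns n xi = 0.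
Proof.
move=> y2 yxi ker n0; rewrite (xi_res y2 yxi) /res -gnsM.
set d := - _ *: _.
have -> : cmul n (adj d 0 : Ap) = adj (cmul n.1 d + n.2 *: d) 0.
  by apply: unit_pairP => /=; rewrite ?scale0r ?addr0 ?mulr0.
apply: ker => v; have [_ _ opM _ _] := unit_op_action phi.
have := opM n (adj d 0 : Ap) v; rewrite n0 /unit_op /= mulr0 scale0r add0r.
by rewrite scale0r addr0.
Qed.

End restriction.

Variables (I : choiceType) (F : I -> representation A).
Hypothesis exh : exhausting F.

Lemma nonunital_separation y : y.2 != 0 ->
  (forall d : R[i], 0 < d -> ~ pos one (cmul (cstar y) y - d *: one)) ->
  exists i, forall d : R[i], 0 < d ->
    ~ forall v, d * `|v| ^+ 2 <= `|unit_op (F i) y v| ^+ 2.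
Proof.
move=> y2 /(state_exists oneU)[f [fpos f1 fy fpure]].
have yxi := gns_null oneU fpos fy.
have irr := gns_restriction_irreducible f1 fpure y2 yxi.
have [i ker] := exh irr; exists i => d d0.
have kerE n := gns_restriction_ker (n := n) y2 yxi ker.
exact: (no_lower_bound f1 (unit_op_action (F i)) fy kerE d0).
Qed.

Lemma nonunital_invertible a :
  invertible one (adj a 1) <-> forall i, op_invertible (fun v => v + F i a v).
Proof.
have opE i : (fun v => v + F i a v) = unit_op (F i) (adj a 1).
  by apply/funext => v; rewrite /unit_op /= scale1r.
split=> [ainv i|ainv].
  rewrite opE; apply: invertible_op ainv; first exact: unit_op_action.
  exact: unit_op_bounded.
apply: (family_invertible oneU (fun i => unit_op_action (F i))); last first.
  by move=> i; rewrite -opE.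
move=> y ya; apply: nonunital_separation.
have one_neq0 : (1 : R[i]) != 0 by exact: oner_neq0.
case: ya => ->; first exact: one_neq0.
by rewrite [X in X != 0](_ : _ = 1); last exact: conjc1.
Qed.

Lemma nonunital_norming a (l : R[i]) :
  (exists i, `|adj a l : Ap| = opnorm (fun v => l *: v + F i a v)) \/
  `|adj a l : Ap| = `|l|.
Proof.
have [al|al] := eqVneq `|adj a l : Ap| `|l|; [by right|left].
apply: (family_norming oneU (fun i => unit_op_action (F i)) (a := adj a l)).
(* The scalar part of [yy] says [y.2 ^ 2 = |l + a|^2 - |l|^2], so [y.2 = 0] is the excluded
   equality. *)
move=> y _ yy; apply: nonunital_separation; apply: contra_neq al => y2.
have : `|adj a l : Ap| ^+ 2 * 1 - l^*%C * l = 0.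
  by have := congr1 snd yy; rewrite [LHS]/= y2 mul0r => /esym.
move=> /eqP; rewrite mulr1 subr_eq0 -[_ * l]/(l^* * l)%R -normCKC => /eqP h.
by apply/eqP; rewrite -(@eqrXn2 _ 2)// h.
Qed.

End nonunital.

(** * From strictly norming to faithful *)

Section faithful.
Variables (R : realType) (A : cstarAlgType R).
Variables (I : choiceType) (F : I -> representation A).

Lemma hilbert_sum_single i (v : rep_space (F i)) :
  exists xi : hilbert_sum F, sval xi i = v.
Proof.
pose xi := mathcomp_extra.dfwith (fun j => 0 : rep_space (F j)) i v.
suff fin : (\esum_(j in [set: I]) ((complex.Re `|xi j|) ^+ 2)%:E < +oo)%E.
  by exists (exist _ xi fin); rewrite /= /xi dfwithin.
rewrite -(@eq_esum _ _ _ (fun j => if j \in [set i] then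
  ((complex.Re `|xi j|) ^+ 2)%:E else 0%E)).
  by rewrite -esum_mkcond esum_set1 ?ltry// lee_fin sqr_ge0.
move=> j _; rewrite in_set1; case: eqP => // ij.
by rewrite /xi dfwithout ?normr0 ?expr0n//; apply/eqP => ji; case: ij.
Qed.

Lemma direct_sum_eq a b : direct_sum a = direct_sum b :> (hilbert_sum F -> _) ->
  forall i v, F i a v = F i b v.
Proof.
move=> ab i v; have [xi <-] := hilbert_sum_single v.
exact: (congr1 (fun g => g xi i) ab).
Qed.

End faithful.

Lemma opnorm_eq0 (R : realType) (V : normedModType R[i]) (T : V -> V) :
  (forall v, T v = 0) -> opnorm T = 0.
Proof.
move=> T0; have le v : `|v| <= 1 -> `|T v| <= 0 by rewrite T0 normr0.
apply/eqP; rewrite eq_le opnorm_le//=.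
have := opnorm_ge (lexx 0) le; move=> /(_ 0); rewrite normr0 T0 normr0; apply.
exact: ler01.
Qed.

Theorem proposition3p12 (R : realType) (A : cstarAlgType R)
    (I : choiceType) (F : I -> representation A) :
  (exhausting F -> invertibility_sufficient F /\ strictly_norming F) /\
  (strictly_norming F -> faithful F).
Proof.
split=> [exh|[snu sn] a b ab].
  split; split.
  - by move=> e eU a; exact: unital_invertible.
  - by move=> nu a; exact: nonunital_invertible.
  - by move=> [e eU] a; exact: (unital_norming eU).
  - by move=> nu a l; exact: nonunital_norming.
have Fab i v : F i (a - b) v = 0.
  have := rep_linear (-1) b a v; rewrite scaleN1r addrC => ->.
  by rewrite scaleN1r (direct_sum_eq ab) addNr.
suff : `|a - b| = 0 by move=> /eqP; rewrite normr_eq0 subr_eq0 => /eqP.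
have [u|nu] := pselect (unital A).
  by have [i ->] := snu u (a - b); exact: opnorm_eq0 (Fab i).
(* [A] sits isometrically in [A^+]; at scalar 0 the exceptional alternative also says that the norm
   is 0. *)
rewrite -unit_norm_adj -unit_normE.
have [[i ->]|->] := sn nu (a - b) 0; last exact: normr0.
by apply: opnorm_eq0 => v; rewrite Fab scale0r addr0.
Qed.
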